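(* For every $\varepsilon>0$ there exists a strong-probe local computation algorithm that, on every $d$-regular graph (for any $d$), finds a matching whose expected size is at least $(1-\varepsilon)$ times the size of a maximum matching, using $\left(\frac{1}{\varepsilon}\right)^{O(1/\varepsilon^2)}$ probes per query (independently of $n$ and $d$).
   Context: A strong probe specifies a vertex $v$ of the input graph $G=(V,E)$ and returns the list of all neighbors of $v$. The local computation algorithm may use randomness (a seed chosen before the input); it is queried on an edge $e\in E$ and answers ''yes'' or ''no'', and all answers (for a fixed seed) must be consistent with a single matching $M\subseteq E$. The expectation of $|M|$ is over the randomness of the algorithm; the probe bound holds for every query. *)

(* Defs.v *)
From HB Require Import structures.
From mathcomp Require Import all_boot all_order all_algebra.

Set Implicit Arguments.
Unset Strict Implicit.
Unset Printing Implicit Defensive.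

Import GRing.Theory.

Record sgraph (n : nat) := SGraph {
  adj : rel 'I_n;
  adj_sym : symmetric adj;
  adj_irr : irreflexive adj }.

Definition nbrs n (G : sgraph n) (v : 'I_n) : {set 'I_n} :=
  [set w | adj G v w].

Definition edges n (G : sgraph n) : {set {set 'I_n}} :=
  [set [set p.1; p.2] | p : 'I_n * 'I_n & adj G p.1 p.2].

Definition regular n (G : sgraph n) (d : nat) : Prop :=
  forall v : 'I_n, #|nbrs G v| = d.

Definition matching n (G : sgraph n) (M : {set {set 'I_n}}) : bool :=
  (M \subset edges G) && trivIset M.

Definition max_matching_size n (G : sgraph n) : nat :=
  \max_(M : {set {set 'I_n}} | matching G M) #|M|.

(* A strategy answering one query with adaptive strong probes:
   [Probe v k] probes [v] and resumes as [k N], where [N] is the neighborhood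
   of [v].  The neighborhood is passed as a set, so that no information is
   carried by the order in which the neighbors are listed. *)
Inductive strategy (n : nat) : Type :=
| Answer of bool
| Probe of 'I_n & ({set 'I_n} -> strategy n).

Fixpoint answer n (G : sgraph n) (t : strategy n) : bool :=
  match t with
  | Answer b => b
  | Probe v k => answer G (k (nbrs G v))
  end.

Fixpoint probes n (G : sgraph n) (t : strategy n) : nat :=
  match t with
  | Answer _ => 0
  | Probe v k => (probes G (k (nbrs G v))).+1
  end.

(* The algorithm knows the number [n] of vertices, which are named 0, ..., n-1,
   but neither the edges nor the degree.  The seed is uniform in [lca_seed n];
   a query is an edge, given as the set of its two endpoints. *)
Record lca := LCA {
  lca_seed : nat -> finType;
  lca_seed_gt0 : forall n, 0 < #|lca_seed n|;
  lca_query : forall n, lca_seed n -> {set 'I_n} -> strategy n }.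

Definition lca_output (A : lca) n (G : sgraph n) (s : lca_seed A n) :
    {set {set 'I_n}} :=
  [set e in edges G | answer G (lca_query s e)].

Definition expected_size (R : fieldType) (A : lca) n (G : sgraph n) : R :=
  ((\sum_(s : lca_seed A n) #|lca_output G s|%:R) / #|lca_seed A n|%:R)%R.

(* Main.v *)
(** A maximum matching is approached by rounds of augmentation on a subgraph of
    bounded degree, and every round multiplies the number of probes per query by
    a factor that depends on the length of the augmenting paths only.

    Sparsification.  When the degree [d] exceeds [8 k^3], vertices are colored at
    random and an edge is kept when its endpoints have complementary colors.
    The kept graph is bipartite and, by a second moment estimate, almost regular
    of degree about [4 k^3] after its few overloaded vertices have been cut off,
    so by Koenig's theorem it still has a matching covering all but [2 n / k]
    vertices in expectation.  Smaller degrees need no sparsification.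

    Augmentation.  A round with parameter [l] augments along a random greedy set
    of disjoint augmenting paths with at most [2 l] vertices.  By the theorem of
    Yoshida, Yamamoto and Ito the expected number of recursive calls that decide
    whether a path is selected is at most of the order of the average number of
    paths in conflict with a path; dropping the paths that need many more calls
    costs little and makes the bound deterministic.  If the current matching has
    [g] more unmatched vertices than an optimal one, the round gains about
    [(g - n / l) / 4 l] in expectation.  Taking [l] proportional to the index [j]
    of the round, the gap after [j] rounds is [O (n / j)], and [O (1 / eps)]
    rounds multiply the probes by [(1 / eps) ^ O (1 + 2 + ... + 1 / eps)]. *)
Require Import Defs.
From HB Require Import structures.
From mathcomp Require Import all_classical all_reals all_analysis.
From mathcomp Require Import all_boot all_order all_algebra.
From mathcomp Require Import zify ring lra.

Set Implicit Arguments.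
Unset Strict Implicit.
Unset Printing Implicit Defensive.

Import Order.TTheory GRing.Theory Num.Theory.

(** * Probing decision trees *)

Section DecisionTrees.
Variable n : nat.
Local Notation V := 'I_n.
Local Notation graph := (sgraph n).

(** Strategies with answers in any type, so that probing computations can be composed; only the
    final Boolean one becomes a [strategy]. *)
Inductive dtree (X : Type) : Type :=
| Leaf of X
| Node of V & ({set V} -> dtree X).

Fixpoint teval X (G : graph) (t : dtree X) : X :=
  match t with Leaf x => x | Node v k => teval G (k (nbrs G v)) end.

Fixpoint tcost X (G : graph) (t : dtree X) : nat :=
  match t with Leaf _ => 0 | Node v k => (tcost G (k (nbrs G v))).+1 end.

Fixpoint tbind X Y (t : dtree X) (f : X -> dtree Y) : dtree Y :=
  match t with Leaf x => f x | Node v k => Node v (fun N => tbind (k N) f) end.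

(** Out of budget means [false]: cutting can deselect a path but never select one. *)
Fixpoint tcut (b : nat) (t : dtree bool) : dtree bool :=
  match t with
  | Leaf x => Leaf x
  | Node v k => if b is b'.+1 then Node v (fun N => tcut b' (k N)) else Leaf false
  end.

Fixpoint strategy_of (t : dtree bool) : strategy n :=
  match t with
  | Leaf b => Answer n b
  | Node v k => Probe v (fun N => strategy_of (k N))
  end.

Lemma answer_strategy_of G t : answer G (strategy_of t) = teval G t.
Proof. by elim: t => //= v k IH; rewrite IH. Qed.

Lemma probes_strategy_of G t : probes G (strategy_of t) = tcost G t.
Proof. by elim: t => //= v k IH; rewrite IH. Qed.

Lemma teval_bind X Y G (t : dtree X) (f : X -> dtree Y) :
  teval G (tbind t f) = teval G (f (teval G t)).
Proof. by elim: t => //= v k IH; rewrite IH. Qed.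

Lemma tcost_bind X Y G (t : dtree X) (f : X -> dtree Y) :
  tcost G (tbind t f) = tcost G t + tcost G (f (teval G t)).
Proof. by elim: t => //= v k IH; rewrite IH addSn. Qed.

Lemma tcost_cut G b t : tcost G (tcut b t) <= b.
Proof. by elim: t b => [x|v k IH] [|b] //=; rewrite ltnS. Qed.

Lemma teval_cut_sub G b t : teval G (tcut b t) -> teval G t.
Proof. by elim: t b => [x|v k IH] [|b] //=; apply: IH. Qed.

Lemma teval_cut G b t : tcost G t <= b -> teval G (tcut b t) = teval G t.
Proof. by elim: t b => [x|v k IH] [|b] //= le; apply: IH. Qed.

(** The tree is fixed before the graph, while the bound on its cost may depend on the graph. The
    result lives in [Type] because the final query is built from the tree it carries. *)
Definition local X (q : graph -> nat) (F : graph -> X) : Type :=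
  {t : dtree X | forall G, teval G t = F G /\ tcost G t <= q G}.

Lemma local_const X (x : X) : local (fun _ => 0) (fun _ => x).
Proof. by exists (Leaf x). Qed.

Lemma local_sub X q q' (F F' : graph -> X) :
  (forall G, q G <= q' G) -> F =1 F' -> local q F -> local q' F'.
Proof.
move=> le_q eqF [t tP]; exists t => G.
by have [eqt le_t] := tP G; rewrite -eqF; split=> //; apply: leq_trans (le_q G).
Qed.

Lemma local_bind X Y q (F : graph -> X) q' (K : X -> graph -> Y) :
  local q F -> (forall x, local (q' x) (K x)) ->
  local (fun G => q G + q' (F G) G) (fun G => K (F G) G).
Proof.
move=> [t tP] lK; exists (tbind t (fun x => sval (lK x))) => G.
have [<- le_t] := tP G; rewrite teval_bind tcost_bind.
by case: (lK (teval G t)) => u uP /=; have [-> le_u] := uP G; rewrite leq_add.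
Qed.

Lemma local_map X Y q (F : graph -> X) (f : X -> Y) :
  local q F -> local q (fun G => f (F G)).
Proof.
move=> lF; apply: local_sub (local_bind lF (fun x => local_const (f x))) => //.
by move=> G; rewrite addn0.
Qed.

Lemma local_nbrs v : local (fun _ => 1) (fun G => nbrs G v).
Proof. by exists (Node v (fun N => Leaf N)). Qed.

Lemma local_seq (I : Type) X q (F : I -> graph -> X) (s : seq I) :
  (forall i, local q (F i)) ->
  local (fun G => size s * q G) (fun G => [seq F i G | i <- s]).
Proof.
move=> lF; elim: s => [|i s IH]; first exact: local_const.
have lK x := local_map (cons x) IH.
apply: local_sub (local_bind (lF i) lK) => // G.
Qed.

Lemma local_mask (X : Type) q (x0 : V -> X) (F : V -> graph -> X) (A : {set V}) :
  (forall v, local q (F v)) ->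
  local (fun G => #|A| * q G)
    (fun G => [ffun v => if v \in A then F v G else x0 v]).
Proof.
move=> lF; pose f (s : seq X) := [ffun v => nth (x0 v) s (index v (enum A))].
apply: local_sub (local_map f (local_seq (enum A) lF)) => [G|G].
  by rewrite -cardE.
apply/ffunP => v; rewrite !ffunE; case: ifPn => vA.
  by rewrite (nth_map v) ?index_mem ?mem_enum // nth_index ?mem_enum.
by rewrite nth_default // size_map leqNgt index_mem mem_enum.
Qed.

(* Evaluation stops at the first index that answers [true], so the indices
   after it cost nothing. *)
Fixpoint lazy_cost (I : Type) (q : I -> nat) (F : pred I) (s : seq I) : nat :=
  if s is i :: s' then q i + (if F i then 0 else lazy_cost q F s') else 0.

Lemma lazy_cost_rcons (I : Type) q (F : pred I) s i :
  lazy_cost q F (rcons s i) = lazy_cost q F s + (if has F s then 0 else q i).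
Proof.
elim: s => [|j s IH] /=; first by case: (F i); rewrite !addn0.
by rewrite IH; case: (F j); rewrite /= ?addn0 ?addnA.
Qed.

Lemma local_has (I : eqType) (q : I -> graph -> nat) (F : I -> graph -> bool)
    (s : seq I) :
  (forall i, i \in s -> local (q i) (F i)) ->
  local (fun G => lazy_cost (q^~ G) (F^~ G) s) (fun G => has (F^~ G) s).
Proof.
elim: s => [|i s IH] lF; first exact: local_const.
have lFi : local (q i) (F i) by apply: lF; rewrite mem_head.
have {}IH := IH (fun j js => lF j (mem_behead (s := i :: s) js)).
pose q' (b : bool) G := if b then 0 else lazy_cost (q^~ G) (F^~ G) s.
have lK (b : bool) : local (q' b) (fun G => b || has (F^~ G) s).
  by case: b; [exact: local_const | exact: IH].
exact: local_sub (local_bind lFi lK).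
Qed.

(** This turns a cost that is only small on average into a worst-case bound [b], at the price of
    losing the positive answers that cost more. *)
Lemma local_cut (b : nat) q (F : graph -> bool) : local q F ->
  {F' : graph -> bool & (local (fun _ => b) F' *
    (forall G, (F' G -> F G) /\ (F G -> q G <= b -> F' G)))%type}.
Proof.
move=> [t tP]; exists (fun G => teval G (tcut b t)); split.
  by exists (tcut b t) => G; rewrite tcost_cut.
move=> G; have [<- le_t] := tP G; split; first exact: teval_cut_sub.
by move=> Ft le_q; rewrite teval_cut // (leq_trans le_t).
Qed.

End DecisionTrees.

(** * Query cost of random greedy independent sets *)

Section Greedy.
Variables (T : eqType) (c : rel T).
Hypotheses (c_sym : symmetric c) (c_irr : irreflexive c).

Definition reveal_cost (z : T) (A : T -> nat) (U : pred T) (y : T) : nat :=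
  A y + (if c z y && U y then A z else 0).

Definition reveal_free (z : T) (U : pred T) (y : T) : bool :=
  U y && ~~ (c z y && U z).

(** Deciding whether [z] is free after [w 0], ..., [w i.-1] queries its neighbors among them in
    increasing rank, until one is found to be selected. The parameters [A] and [U] carry the costs
    and the free vertices left by earlier revelations. *)
Fixpoint greedy (A : T -> nat) (U : pred T) (w : nat -> T) (i : nat) (z : T) :
    nat * bool :=
  if i is j.+1 then
    let: (a, u) := greedy A U w j z in
    let: (a', u') := greedy A U w j (w j) in
    (a + (if c (w j) z && u then a' else 0), u && ~~ (c (w j) z && u'))
  else (A z, U z).

Definition gcost A U w i z := (greedy A U w i z).1.
Definition gfree A U w i z := (greedy A U w i z).2.

Lemma gcostS A U w i z : gcost A U w i.+1 z =
  gcost A U w i z + (if c (w i) z && gfree A U w i z then gcost A U w i (w i) else 0).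
Proof.
rewrite /gcost /gfree /=.
by case: (greedy A U w i z) => a u; case: (greedy A U w i (w i)).
Qed.

Lemma gfreeS A U w i z : gfree A U w i.+1 z =
  gfree A U w i z && ~~ (c (w i) z && gfree A U w i (w i)).
Proof.
rewrite /gfree /=.
by case: (greedy A U w i z) => a u; case: (greedy A U w i (w i)).
Qed.

(** The definition recurses on the last vertex of the order, whereas the induction on random orders
    reveals the first one; its effect is absorbed in [A] and [U]. *)
Lemma greedy_shift A U w i z :
  (gcost A U w i.+1 z =
     gcost (reveal_cost (w 0) A U) (reveal_free (w 0) U) (w \o succn) i z) /\
  (gfree A U w i.+1 z =
     gfree (reveal_cost (w 0) A U) (reveal_free (w 0) U) (w \o succn) i z).
Proof.
elim: i z => [|i IH] z //.
have [Cz Fz] := IH z; have [Cw Fw] := IH (w i.+1).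
split; first by rewrite gcostS [RHS]gcostS Cz Fz Cw.
by rewrite gfreeS [RHS]gfreeS Fz Fw.
Qed.

Definition greedy_total A U (x0 : T) (s : seq T) :=
  \sum_(i < size s) gcost A U (nth x0 s) i (nth x0 s i).

Lemma greedy_total_cons A U x0 z s : greedy_total A U x0 (z :: s) =
  A z + greedy_total (reveal_cost z A U) (reveal_free z U) x0 s.
Proof.
rewrite /greedy_total /= big_ord_recl; congr (_ + _).
apply: eq_bigr => i _.
by have [-> _] := greedy_shift A U (nth x0 (z :: s)) i (nth x0 s i).
Qed.

(** The potential of the induction. For unit costs and no dominated vertex it counts the ordered
    conflicting pairs. *)
Definition pairs (A : T -> nat) (U : pred T) (s : seq T) :=
  \sum_(x <- s) \sum_(y <- s) (if c x y && U y then A x else 0).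

Lemma sum_rem (s : seq T) z (F : T -> nat) : uniq s -> z \in s ->
  \sum_(x <- rem z s) F x = \sum_(x <- s | x != z) F x.
Proof. by move=> us zs; rewrite rem_filter // big_filter. Qed.

Lemma sum_neq_const (s : seq T) x a : uniq s -> x \in s ->
  \sum_(z <- s | z != x) a = (size s).-1 * a.
Proof.
by move=> us xs; rewrite -sum_rem // big_const_seq count_predT size_rem // iter_addn_0 mulnC.
Qed.

Lemma sum_neq2_const (s : seq T) x y a : uniq s -> x \in s -> y \in s -> x != y ->
  \sum_(z <- s | (x != z) && (y != z)) a = (size s).-2 * a.
Proof.
move=> us xs ys xy; transitivity (\sum_(z <- rem y s | z != x) a).
  rewrite rem_filter // big_filter_cond; apply: eq_bigl => z /=.
  by rewrite andbC [y == _]eq_sym [x == _]eq_sym.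
rewrite sum_neq_const ?rem_uniq ?size_rem //.
by rewrite rem_filter // mem_filter /= xy.
Qed.

Lemma sum_permutations (s : seq T) (F : seq T -> nat) : uniq s -> 0 < size s ->
  \sum_(p <- permutations s) F p =
  \sum_(z <- s) \sum_(p <- permutations (rem z s)) F (z :: p).
Proof.
move=> us s_gt0; rewrite (perm_big _ (permutationsE s_gt0)) undup_id //=.
by rewrite big_allpairs_dep.
Qed.

Definition triple (A : T -> nat) (U : pred T) x y z :=
  if [&& x != z, c x y, U y, c y z & U z] then A x else 0.

(** The triples on the left are lost by pairs [(x, y)] whose [y] becomes dominated by [z]; those on
    the right are gained by pairs [(x, y)] whose [x] is now charged with [A z]. *)
Lemma reveal_pairs A U s z : uniq s -> z \in s ->
  pairs (reveal_cost z A U) (reveal_free z U) (rem z s) +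
    \sum_(x <- s) \sum_(y <- s) triple A U x y z <=
  \sum_(x <- s) \sum_(y <- s)
     (if [&& x != z, y != z, c x y & U y] then A x else 0) +
  \sum_(x <- s) \sum_(y <- s) triple A U z x y.
Proof.
move=> us zs; rewrite /pairs sum_rem // big_mkcond -!big_split /=.
apply: leq_sum => x _; rewrite sum_rem //.
rewrite [X in (if _ then X else _)]big_mkcond /=.
case: eqVneq => [->|xz] /=.
  rewrite add0n; apply: leq_trans (leq_addr _ _).
  by apply: leq_sum => y _; rewrite /triple eqxx.
rewrite -!big_split; apply: leq_sum => y _ /=.
rewrite /triple /reveal_cost /reveal_free xz /= [z == y]eq_sym.
have [->|yz] /= := eqVneq y z; first by rewrite c_irr andbF !andbF.
rewrite [c z y]c_sym.
by case: (c x y); case: (U y); case: (c y z); case: (U z); case: (c z x);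
  case: (U x); rewrite /= ?addn0 ?add0n ?leqnn ?leq_addr.
Qed.

(** Summed over [z], both sums of triples run over the same paths and cancel. Each remaining pair
    survives for the [(size s).-2] choices of [z] outside it. *)
Lemma sum_reveal_pairs A U s : uniq s ->
  \sum_(z <- s) pairs (reveal_cost z A U) (reveal_free z U) (rem z s) <=
  (size s).-2 * pairs A U s.
Proof.
move=> us; pose tri := \sum_(x <- s) \sum_(y <- s) \sum_(z <- s) triple A U x y z.
rewrite -(leq_add2r tri) {1}/tri.
have -> : \sum_(x <- s) \sum_(y <- s) \sum_(z <- s) triple A U x y z =
          \sum_(z <- s) \sum_(x <- s) \sum_(y <- s) triple A U x y z.
  rewrite [RHS]exchange_big /=; apply: eq_bigr => x _.
  by rewrite exchange_big.
rewrite -big_split /=; apply: leq_trans.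
  rewrite big_seq; apply: leq_sum => z zs; exact: reveal_pairs.
rewrite -big_seq big_split /= leq_add2r /pairs.
rewrite exchange_big /= big_distrr /=.
rewrite big_seq [leqRHS]big_seq; apply: leq_sum => x xs.
rewrite exchange_big /= big_distrr /=.
rewrite big_seq [leqRHS]big_seq; apply: leq_sum => y ys.
case: ifP => cU; last by rewrite muln0 big1 // => z _; rewrite !andbF.
have xy : x != y by apply: contraTneq cU => ->; rewrite c_irr.
rewrite -(sum_neq2_const (A x) us xs ys xy) [leqRHS]big_mkcond /=.
by apply: leq_sum => z _; rewrite andbT.
Qed.

Lemma sum_reveal_cost A U s : uniq s ->
  \sum_(z <- s) (A z + \sum_(x <- rem z s) reveal_cost z A U x) =
  size s * (\sum_(x <- s) A x) + pairs A U s.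
Proof.
move=> us; have step z : z \in s ->
    A z + \sum_(x <- rem z s) reveal_cost z A U x =
    \sum_(x <- s) A x + \sum_(x <- s) (if c z x && U x then A z else 0).
  move=> zs; rewrite big_split /= addnA; congr (_ + _).
    by rewrite [RHS](perm_big _ (perm_to_rem zs)) big_cons.
  by rewrite [RHS](perm_big _ (perm_to_rem zs)) big_cons c_irr.
rewrite big_seq (eq_bigr _ step) -big_seq big_split /=; congr (_ + _).
by rewrite big_const_seq count_predT iter_addn_0 mulnC.
Qed.

(* The expected query cost of random greedy independent sets (Yoshida,
   Yamamoto and Ito), by induction on the vertices still to be revealed: for
   every path [x - y - z] with [y], [z] undominated, revealing [x] first adds
   [A x] to the pair [(y, z)] and revealing [z] first removes [A x] from the
   pair [(x, y)], so these contributions cancel on average. *)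
Theorem greedy_expected_cost A U x0 s : uniq s ->
  \sum_(p <- permutations s) 2 * greedy_total A U x0 p <=
  (size s)`! * (2 * \sum_(x <- s) A x + pairs A U s).
Proof.
elim: {s}(size s) {-2}s (erefl (size s)) A U => [|k IH] s sz A U us.
  move/size0nil: sz => -> /=; rewrite /permutations /= big_cons big_nil /greedy_total /=.
  by rewrite big_ord0.
rewrite sum_permutations ?sz //.
pose bnd z := k`! * (2 * (A z + \sum_(x <- rem z s) reveal_cost z A U x) +
   pairs (reveal_cost z A U) (reveal_free z U) (rem z s)).
apply: (@leq_trans (\sum_(z <- s) bnd z)).
  rewrite big_seq [leqRHS]big_seq; apply: leq_sum => z zs.
  have szr : size (rem z s) = k by rewrite size_rem // sz.
  have ur : uniq (rem z s) by rewrite rem_uniq.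
  rewrite (eq_bigr (fun p => 2 * A z +
    2 * greedy_total (reveal_cost z A U) (reveal_free z U) x0 p)); last first.
    by move=> p _; rewrite greedy_total_cons mulnDr.
  rewrite big_split /= big_const_seq count_predT iter_addn_0 size_permutations // szr.
  have := IH _ szr (reveal_cost z A U) (reveal_free z U) ur.
  move=> le; rewrite /bnd [2 * (A z + _)]mulnDr -addnA mulnDr.
  by rewrite szr in le; apply: leq_add => //; rewrite mulnC.
rewrite /bnd -big_distrr /= big_split /= -big_distrr /= sum_reveal_cost //.
rewrite factS [k.+1 * _]mulnC -mulnA leq_mul2l; apply/orP; right.
have := sum_reveal_pairs A U us; rewrite sz /=.
(* With a single vertex [(size s).-2] is truncated to 0 where the computation needs -1; then there
   are no pairs at all. *)
case: k sz {IH bnd} => [|k] sz /=; last first.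
  by set S := \sum_(x <- s) A x; set P := pairs A U s; set Q := \sum_(z <- s) _; nia.
have [z sE] : exists z, s = [:: z] by case: s sz {us} => [|z [|]] // _; exists z.
have -> : pairs A U s = 0 by rewrite /pairs sE !big_seq1 c_irr.
by set S := \sum_(x <- s) A x; set Q := \sum_(z <- s) _; lia.
Qed.

End Greedy.

(** * Matchings as involutions, augmenting walks *)

Section Mates.
Variable n : nat.
Local Notation V := 'I_n.
Implicit Types (H : sgraph n) (m : V -> V) (v x y : V).

(* A matching is represented by the involution that exchanges the endpoints of
   each of its edges and fixes the unmatched vertices. *)
Definition is_mate H m : Prop :=
  forall v, m (m v) = v /\ (m v != v -> adj H v (m v)).

Definition unmatched m : {set V} := [set v | m v == v].

Lemma mateK H m : is_mate H m -> involutive m.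
Proof. by move=> mm v; case: (mm v). Qed.

Lemma mate_adj H m v : is_mate H m -> m v != v -> adj H v (m v).
Proof. by move=> mm; case: (mm v). Qed.

Local Notation info := {ffun V -> {set V} * V}.
Implicit Types d : info.

Definition info_of H m : info := [ffun v => (nbrs H v, m v)].

(** Outside [B] a vertex looks isolated and unmatched. The predicates on walks read only the entries
    of their own vertices, so the masked information decides every walk inside [B]. *)
Definition mask_info (B : {set V}) (d : info) : info :=
  [ffun v => if v \in B then d v else (set0, v)].

(** Staying in place is allowed, so that shorter paths can be padded to one fixed length. *)
Definition walk_step (d : info) : rel V := fun x y => (x == y) || (y \in (d x).1).

Definition rematches (d : info) (z : seq V) (r : {ffun V -> V}) : bool :=
  all (fun v => [&& r v \in z, r (r v) == v & r v \in (d v).1]) z.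

(* An augmenting path is only kept as the set of vertices of a walk: it is
   closed under the current matching, contains an unmatched vertex and can be
   perfectly rematched. *)
Definition augmenting (d : info) (z : seq V) : bool :=
  [&& sorted (walk_step d) z, all (fun v => (d v).2 \in z) z,
      has (fun v => (d v).2 == v) z & [exists r, rematches d z r]].

(** The choice depends only on the information along [z], so all vertices of [z] agree on it without
    communication. *)
Definition rematching (d : info) (z : seq V) : {ffun V -> V} :=
  odflt [ffun v => v] [pick r | rematches d z r].

Lemma eq_rematches d d' (z : seq V) r : {in z, d =1 d'} ->
  rematches d z r = rematches d' z r.
Proof. by move=> eqd; apply: eq_in_all => v vz; rewrite eqd. Qed.

Lemma eq_augmenting d d' (z : seq V) : {in z, d =1 d'} ->
  augmenting d z = augmenting d' z.
Proof.
move=> eqd; rewrite /augmenting; congr [&& _, _, _ & _].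
- apply: (@eq_in_sorted _ (mem z)); last exact/allP.
  by move=> x y xz _; rewrite /walk_step eqd.
- by apply: eq_in_all => v vz; rewrite eqd.
- by apply: eq_in_has => v vz; rewrite eqd.
- by apply: eq_existsb => r; apply: eq_rematches.
Qed.

Lemma eq_rematching d d' (z : seq V) : {in z, d =1 d'} ->
  rematching d z = rematching d' z.
Proof.
by move=> eqd; rewrite /rematching (eq_pick (fun r => eq_rematches r eqd)).
Qed.

Lemma rematchingP d z : augmenting d z -> rematches d z (rematching d z).
Proof.
case/and4P => _ _ _ /existsP[r rz]; rewrite /rematching.
by case: pickP => [//|/(_ r)]; rewrite rz.
Qed.

Definition ball H (A : {set V}) (i : nat) : {set V} :=
  iter i (fun B => B :|: \bigcup_(v in B) nbrs H v) A.

Lemma ballS H A i :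
  ball H A i.+1 = ball H A i :|: \bigcup_(v in ball H A i) nbrs H v.
Proof. by []. Qed.

Lemma sub_ball H A i j : i <= j -> ball H A i \subset ball H A j.
Proof.
move/subnK => <-; elim: (j - i) => // k IH.
by rewrite addSn ballS; apply: subset_trans IH (subsetUl _ _).
Qed.

Lemma card_bigcup_leq (I : finType) (A : {set I}) (F : I -> {set V}) b :
  (forall i, i \in A -> #|F i| <= b) -> #|\bigcup_(i in A) F i| <= #|A| * b.
Proof.
move=> le_b; rewrite -sum_nat_const.
elim/big_rec2: _ => [|i N B iA leB]; first by rewrite cards0.
by rewrite (leq_trans (leq_card_setU _ _)) // leq_add ?le_b.
Qed.

Lemma card_ball H A i D : (forall v, #|nbrs H v| <= D) ->
  #|ball H A i| <= #|A| * D.+1 ^ i.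
Proof.
move=> leD; elim: i => [|i IH]; first by rewrite muln1.
rewrite ballS (leq_trans (leq_card_setU _ _)) //.
have le := card_bigcup_leq (A := ball H A i) (fun v _ => leD v).
rewrite (leq_trans (leq_add (leqnn _) le)) //.
by rewrite -mulnS expnS mulnCA mulnC leq_mul2l IH orbT.
Qed.

Lemma walk_step_sym H m : symmetric (walk_step (info_of H m)).
Proof.
by move=> x y; rewrite /walk_step !ffunE !inE eq_sym adj_sym.
Qed.

Lemma walk_step_ball H m A i x y :
  walk_step (info_of H m) x y -> x \in ball H A i -> y \in ball H A i.+1.
Proof.
rewrite /walk_step ffunE ballS => /orP[/eqP <-|xy] xB; rewrite inE ?xB //.
by apply/orP; right; apply/bigcupP; exists x.
Qed.

Lemma walk_sub_ball H m (A : {set V}) (z : seq V) x :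
  sorted (walk_step (info_of H m)) z -> x \in z -> x \in A ->
  {subset z <= ball H A (size z)}.
Proof.
move=> zw /(nthP x)[i lt_i <-] iA y /(nthP x)[j lt_j <-].
have zP k : k.+1 < size z -> walk_step (info_of H m) (nth x z k) (nth x z k.+1).
  exact: (sortedP x zw).
have up k : i + k < size z -> nth x z (i + k) \in ball H A k.
  elim: k => [|k IH] lt_k; first by rewrite addn0.
  rewrite addnS in lt_k *.
  by apply: walk_step_ball (IH (ltnW lt_k)); apply: zP.
have dn k : k <= i -> nth x z (i - k) \in ball H A k.
  elim: k => [|k IH] lt_k; first by rewrite subn0.
  apply: walk_step_ball (IH (ltnW lt_k)); rewrite walk_step_sym -(subnSK lt_k).
  by apply: zP; rewrite subnSK // (leq_ltn_trans (leq_subr _ _)).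
have [le_ij|lt_ji] := leqP i j.
  have le_z : j - i <= size z by rewrite (leq_trans (leq_subr _ _)) // ltnW.
  apply: (subsetP (sub_ball H A le_z)).
  by rewrite -{1}(subnKC le_ij) up // subnKC.
have le_z : i - j <= size z by rewrite (leq_trans (leq_subr _ _)) // ltnW.
apply: (subsetP (sub_ball H A le_z)).
by rewrite -{1}(subKn (ltnW lt_ji)) dn // leq_subr.
Qed.

(** Walks of [s] steps are grown in both directions from their vertex [x] at position [i], which
    makes their number independent of [n]. *)
Fixpoint walks_at (e : rel V) (s : nat) (i : nat) (x : V) : seq (seq V) :=
  if s is s'.+1 then
    if i is i'.+1 then
      flatten [seq [seq y :: w | y <- enum (e (head x w))] | w <- walks_at e s' i' x]
    else flatten [seq [seq x :: w | w <- walks_at e s' 0 y] | y <- enum (e x)]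
  else [:: [:: x]].

Lemma size_flatten_leq (S X : Type) (f : S -> seq X) (s : seq S) b :
  (forall a, size (f a) <= b) -> size (flatten (map f s)) <= size s * b.
Proof.
move=> le_b; elim: s => //= x s IH.
by rewrite size_cat mulSn leq_add.
Qed.

Lemma size_walks_at (e : rel V) D s i x : (forall v, #|e v| <= D) ->
  size (walks_at e s i x) <= D ^ s.
Proof.
move=> leD; elim: s i x => [|s IH] i x //.
have szD v : size (enum (e v)) <= D by rewrite -cardE.
case: i => [|i] /=; rewrite expnS.
  apply: (leq_trans (size_flatten_leq _ (b := D ^ s) _)).
    by move=> y; rewrite size_map.
  by rewrite leq_mul2r szD orbT.
apply: (leq_trans (size_flatten_leq _ (b := D) _)).
  by move=> w; rewrite size_map.
by rewrite mulnC leq_mul2l IH orbT.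
Qed.

Lemma mem_walks_at (e : rel V) s i x0 x (z : seq V) : symmetric e ->
  size z = s.+1 -> sorted e z -> i <= s -> nth x0 z i = x ->
  z \in walks_at e s i x.
Proof.
move=> e_sym; elim: s i x z => [|s IH] i x z.
  by case: z => [|y [|]] //; case: i => // _ _ _ /= ->; rewrite mem_seq1.
case: z => [|y [|y' z]] //= [sz] /andP[yy' zw]; case: i => [|i] /= le_i nthx.
  subst y; apply/flattenP.
  exists [seq x :: w | w <- walks_at e s 0 y'].
    by apply/mapP; exists y' => //; rewrite mem_enum.
  by rewrite mem_map; [apply: IH => //=; rewrite sz | move=> ? ? []].
have zin : y' :: z \in walks_at e s i x by apply: IH => //=; rewrite sz.
apply/flattenP; exists [seq v :: (y' :: z) | v <- enum (e y')].
  by apply/mapP; exists (y' :: z).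
by rewrite mem_map ?mem_enum ?[_ \in _]e_sym //; move=> ? ? [].
Qed.

Lemma card_walk_step H m D v : (forall v, #|nbrs H v| <= D) ->
  #|walk_step (info_of H m) v| <= D.+1.
Proof.
move=> leD.
have -> : #|walk_step (info_of H m) v| = #|v |: nbrs H v|.
  by apply: eq_card => w; rewrite !inE -topredE /= /walk_step ffunE inE eq_sym.
by rewrite (leq_trans (leq_card_setU _ _)) // cards1 add1n ltnS.
Qed.

(** A walk meeting [A] is determined by a vertex of [A] on it, the position of that vertex, and
    fewer than [s] steps with at most [D.+1] choices each. *)
Lemma card_walks_hitting H m D s (P : pred (s.-tuple V)) (A : seq V) :
  (forall v, #|nbrs H v| <= D) ->
  (forall z, P z -> sorted (walk_step (info_of H m)) z /\ has (mem z) A) ->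
  #|P| <= size A * (s * D.+1 ^ s).
Proof.
move=> leD Ph; case: s P Ph => [|s] P Ph.
  rewrite mul0n muln0 leqn0; apply/eqP/eq_card0 => z; rewrite !inE.
  by apply/negP => /Ph[_]; rewrite tuple0 => /hasP[].
pose e := walk_step (info_of H m).
pose all_walks := flatten [seq flatten [seq walks_at e s i x | i <- iota 0 s.+1] | x <- A].
have sz : size all_walks <= size A * (s.+1 * D.+1 ^ s.+1).
  apply: size_flatten_leq => x; rewrite -{2}(size_iota 0 s.+1).
  apply: size_flatten_leq => i.
  by rewrite (leq_trans (size_walks_at _ _ _ (fun v => card_walk_step m v leD))) // leq_pexp2l.
apply: leq_trans sz; rewrite cardE -(size_map val).
apply: uniq_leq_size; first by rewrite (map_inj_uniq val_inj) enum_uniq.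
move=> _ /mapP[z + ->]; rewrite mem_enum => /Ph[zw /hasP[x xA xz]].
have lt_x : index x z < s.+1 by move: xz; rewrite /= -index_mem size_tuple.
apply/flattenP; exists (flatten [seq walks_at e s i x | i <- iota 0 s.+1]).
  by apply/mapP; exists x.
apply/flattenP; exists (walks_at e s (index x z) x).
  apply/mapP; exists (index x z) => //.
  by rewrite mem_iota.
apply: (@mem_walks_at _ _ _ x); rewrite ?size_tuple ?nth_index //.
exact: walk_step_sym.
Qed.

End Mates.

(** * Alternating walks between two matchings *)

Lemma card_leq_rel (S S' : finType) (A : {set S}) (B : {set S'}) (r : S -> S' -> bool) :
  (forall a, a \in A -> exists2 b, b \in B & r a b) ->
  (forall a a' b, a \in A -> a' \in A -> r a b -> r a' b -> a = a') ->
  #|A| <= #|B|.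
Proof.
move=> rex rinj; pose g a := [pick b in B | r a b].
have gP a : a \in A -> exists2 b, b \in B & r a b /\ g a = Some b.
  move=> aA; rewrite /g; case: pickP => [b /andP[bB ab]|no]; first by exists b.
  by have [b bB ab] := rex a aA; have := no b; rewrite bB ab.
have ginj : {in A &, injective g}.
  move=> a a' aA a'A; have [b bB [ab ->]] := gP a aA.
  by have [b' _ [ab' ->]] := gP a' a'A => -[eqb]; apply: rinj ab _; rewrite // eqb.
have Sinj : injective (@Some S') by move=> b b' [].
rewrite -(card_in_imset ginj) -(card_imset (mem B) Sinj).
apply/subset_leq_card/subsetP => _ /imsetP[a aA ->].
by have [b bB [_ ->]] := gP a aA; apply: imset_f.
Qed.

Section Alternating.
Variables (n : nat) (H : sgraph n) (m nn : 'I_n -> 'I_n).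
Hypotheses (mm : is_mate H m) (mnn : is_mate H nn).
Local Notation V := 'I_n.

(** The position after [i] rounds of the walk from [u] that alternates between [nn] and [m]. Below,
    [alive u j] says that the first [j] rounds meet no vertex where the walk gets stuck, and [y]
    lists the vertices one step at a time. *)
Let x (u : V) i := iter i (m \o nn) u.

Let alive (u : V) j :=
  [forall i : 'I_j, (nn (x u i) != x u i) && (m (nn (x u i)) != nn (x u i))].

Let aliveP u j i : alive u j -> i < j ->
  nn (x u i) != x u i /\ m (nn (x u i)) != nn (x u i).
Proof. by move=> /forallP al lt_ij; apply/andP/(al (Ordinal lt_ij)). Qed.

Let alive0 u : alive u 0.
Proof. by apply/forallP => -[]. Qed.

Let aliveS u j : alive u j -> nn (x u j) != x u j ->
  m (nn (x u j)) != nn (x u j) -> alive u j.+1.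
Proof.
move=> al nx mx; apply/forallP => -[i /=]; rewrite ltnS leq_eqVlt.
by case/orP => [/eqP ->|/(aliveP al)[-> ->]]; rewrite ?nx ?mx.
Qed.

(** Each round is injective, so two walks that meet can be run backwards until one of them is at its
    start. If the other is not, it entered this vertex along an edge of [m], but the start is
    unmatched by [m]. *)
Let alive_inj u u' i i' : m u = u -> m u' = u' -> alive u i -> alive u' i' ->
  x u i = x u' i' -> u = u' /\ i = i'.
Proof.
wlog le_i : u u' i i' / i <= i'.
  move=> wl mu mu' al al' eqx; have [le_i|/ltnW le_i] := leqP i i'; first exact: wl.
  by have [] := wl u' u i' i le_i mu' mu al' al (esym eqx).
move=> mu mu' al al'; rewrite /x -(subnKC le_i) iterD.
have injf : injective (m \o nn).
  by apply: inj_comp; apply: inv_inj; [exact: mateK mm | exact: mateK mnn].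
have injI k : injective (iter k (m \o nn)).
  by elim: k => [|k IH] // a b /= /injf/IH.
move/injI; case e: (i' - i) => [|k]; first by move=> ->; rewrite addn0.
move=> uE; have lt_k : k < i' by lia.
have [_ /eqP[]] := aliveP al' lt_k.
have eqm : m (nn (x u' k)) = u by rewrite uE.
by rewrite -[RHS](mateK mm) eqm mu.
Qed.

Let y u k := if odd k then nn (x u k./2) else x u k./2.

Let y_mate u j k : m u = u -> alive u j -> nn (x u j) != x u j ->
  m (nn (x u j)) = nn (x u j) -> k < j.*2.+2 ->
  [/\ exists2 k', k' < j.*2.+2 & m (y u k) = y u k',
      exists2 k', k' < j.*2.+2 & nn (y u k) = y u k',
      nn (y u k) != y u k & k.+1 < j.*2.+2 -> adj H (y u k) (y u k.+1)].
Proof.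
move=> mu al nx mx lt_k; have nxk i : i <= j -> nn (x u i) != x u i.
  by rewrite leq_eqVlt => /orP[/eqP -> //|/(aliveP al)[]].
have le_k : k./2 <= j by lia.
have nk := nxk _ le_k.
case: (boolP (odd k)) => odk.
  have yk : y u k = nn (x u k./2) by rewrite /y odk.
  have kE : k = k./2.*2.+1 by have := odd_double_half k; rewrite odk; lia.
  have yS : y u k.+1 = m (nn (x u k./2)).
    by rewrite /y /= odk /= uphalf_half odk.
  have eqj : (k.+1 < j.*2.+2) || (k./2 == j) by lia.
  split.
  - case/orP: eqj => [lt_Sk|/eqP eqj]; first by exists k.+1; rewrite // yk yS.
    by exists k; rewrite // yk eqj mx.
  - exists k.-1; first by lia.
    rewrite yk (mateK mnn) /y; have -> : odd k.-1 = false by lia.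
    by have -> : k.-1./2 = k./2 by lia.
  - by rewrite yk (mateK mnn) eq_sym.
  - move=> lt_Sk; rewrite yk yS; apply: mate_adj mm _.
    by have [] := aliveP (i := k./2) al; first by lia.
have yk : y u k = x u k./2 by rewrite /y (negbTE odk).
have yS : y u k.+1 = nn (x u k./2).
  by rewrite /y /= odk /= uphalf_half (negbTE odk).
split.
- case: k lt_k le_k nk odk yk yS => [|k] lt_k le_k nk odk yk yS.
    by exists 0; rewrite // yk /= mu.
  exists k; first by lia.
  have hk : k.+1./2 = k./2.+1 by lia.
  have ok : odd k by lia.
  by rewrite yk hk /y ok [LHS](mateK mm).
- by exists k.+1; [lia | rewrite yk yS].
- by rewrite yk.
- by move=> _; rewrite yk yS; apply: mate_adj mnn _.
Qed.

(** The last vertex, at position [j.*2.+1], is repeated up to length [l.*2]. *)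
Let aug_tuple l u j : l.*2.-tuple V :=
  [tuple of mkseq (fun i => y u (minn i j.*2.+1)) l.*2].

Let mem_aug_tuple l u j : j < l -> forall v,
  reflect (exists2 k, k < j.*2.+2 & v = y u k) (v \in aug_tuple l u j).
Proof.
move=> lt_j v; apply: (iffP mapP) => [[i _ ->]|[k lt_k ->]].
  by exists (minn i j.*2.+1); rewrite // ltnS geq_minr.
by exists k; [rewrite mem_iota; lia | congr (y u _); lia].
Qed.

Let aug_tupleP l u j : j < l -> m u = u -> alive u j -> nn (x u j) != x u j ->
  m (nn (x u j)) = nn (x u j) -> augmenting (info_of H m) (aug_tuple l u j).
Proof.
move=> lt_j mu al nx mx; have yP k := y_mate (k := k) mu al nx mx.
have memP := mem_aug_tuple u lt_j; apply/and4P; split.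
- apply/(sortedP u) => i; rewrite size_mkseq => lt_i.
  rewrite !nth_mkseq ?(ltnW lt_i) //.
  have [le_i|gt_i] := leqP i.+1 j.*2.+1.
    have -> : minn i j.*2.+1 = i by lia.
    have [] := yP i; first by lia.
    by move=> _ _ _ /(_ le_i) a; rewrite /walk_step ffunE inE a orbT.
  have -> : minn i j.*2.+1 = j.*2.+1 by lia.
  by rewrite /walk_step eqxx.
- apply/allP => v /memP[k lt_k ->]; rewrite ffunE /=.
  by have [[k' lt_k' ->] _ _ _] := yP k lt_k; apply/memP; exists k'.
- by apply/hasP; exists u; rewrite ?ffunE /= ?mu //; apply/memP; exists 0.
- apply/existsP; exists [ffun v => nn v]; apply/allP => v /memP[k lt_k ->].
  have [_ [k' lt_k' eqk'] nk _] := yP k lt_k.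
  rewrite !ffunE /= (mateK mnn) eqxx inE (mate_adj mnn) //= andbT.
  by rewrite eqk'; apply/memP; exists k'.
Qed.

(* Follow, from every vertex that is matched by [nn] but not by [m], the walk
   alternating between [nn] and [m]: within [l] rounds it either stops at a
   vertex unmatched by [nn], or is augmenting and then meets [X], or visits [l]
   vertices of its own. *)
Lemma unmatched_leq l (X : {set V}) : 0 < l ->
  (forall z : l.*2.-tuple V, augmenting (info_of H m) z ->
     exists2 v, v \in X & v \in z) ->
  l * #|unmatched m| <= l * #|unmatched nn| + l * (2 * #|X|) + n.
Proof.
move=> l_gt0 augX.
pose U := unmatched m :\: unmatched nn; pose W := unmatched nn :\: unmatched m.
have inU u : u \in U -> m u = u /\ nn u != u.
  by rewrite !inE => /andP[? /eqP].
pose U1 := [set u in U | [exists j : 'I_l, alive u j && (nn (x u j) == x u j)]].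
pose U2 := [set u in U | [exists j : 'I_l,
  [&& alive u j, nn (x u j) != x u j & m (nn (x u j)) == nn (x u j)]]].
pose U3 := [set u in U | alive u l].
have cU : #|U| <= #|U1| + #|U2| + #|U3|.
  have -> : U = U1 :|: U2 :|: U3.
    apply/setP => u; rewrite !inE -!andb_orr.
    case uU: (_ && _) => //=; apply/esym.
    suff : forall j, j <= l -> [|| [exists j : 'I_l, alive u j && (nn (x u j) == x u j)],
      [exists j : 'I_l, [&& alive u j, nn (x u j) != x u j & m (nn (x u j)) == nn (x u j)]]
      | alive u j] by move/(_ l (leqnn l)); rewrite orbA.
    elim=> [|j IH] lt_j; first by rewrite alive0 !orbT.
    case/or3P: (IH (ltnW lt_j)) => [->|->|al]; rewrite ?orbT //.
    have [nx|nx] := boolP (nn (x u j) == x u j).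
      by apply/orP; left; apply/existsP; exists (Ordinal lt_j); rewrite al nx.
    have [mx|mx] := boolP (m (nn (x u j)) == nn (x u j)).
      by apply/or3P; apply: Or32; apply/existsP; exists (Ordinal lt_j); rewrite /= al nx mx.
    by rewrite aliveS ?orbT.
  rewrite (leq_trans (leq_card_setU _ _)) // leq_add2r.
  exact: leq_card_setU.
have c1 : #|U1| <= #|W|.
  apply: (@card_leq_rel _ _ _ _ (fun u w => [exists j : 'I_l, alive u j && (w == x u j)])).
    move=> u; rewrite !inE -andbA => /and3P[nu mu /existsP[j /andP[al /eqP nx]]].
    exists (x u j); last by apply/existsP; exists j; rewrite al eqxx.
    rewrite !inE nx eqxx andbT; case: j al nx => -[|j] lt_j /= al nx.
      by have nu0 : nn u = u := nx; rewrite nu0 eqxx in nu.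
    have [_] := aliveP al (ltnSn j).
    by rewrite [X in _ -> X != _](mateK mm) eq_sym.
  move=> u u' w; rewrite !inE => /andP[/andP[_ /eqP mu] _] /andP[/andP[_ /eqP mu'] _].
  move=> /existsP[j /andP[al /eqP ->]] /existsP[j' /andP[al' /eqP eqx]].
  by have [] := alive_inj mu mu' al al' eqx.
(* A vertex of [X] together with the parity of its position determines the walk through it, so each
   vertex of [X] hits at most two augmenting walks. *)
have c2 : #|U2| <= 2 * #|X|.
  have -> : 2 * #|X| = #|setX X [set: bool]| by rewrite cardsX cardsT card_bool mulnC.
  apply: (@card_leq_rel _ _ _ _ (fun u p =>
    [exists j : 'I_l, alive u j && ((if p.2 then nn p.1 else p.1) == x u j)])).
    move=> u; rewrite !inE -andbA => /and3P[nu /eqP mu /existsP[j /and3P[al nx /eqP mx]]].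
    have [v vX] := augX _ (aug_tupleP (ltn_ord j) mu al nx mx).
    case/(mem_aug_tuple u (ltn_ord j)) => k lt_k vE.
    exists (v, odd k); first by rewrite !inE vX.
    have lt_l : k./2 < l by have := ltn_ord j; lia.
    apply/existsP; exists (Ordinal lt_l) => /=; apply/andP; split.
      apply/forallP => i; apply/andP/(aliveP al); have := ltn_ord i; move: lt_k => /=; lia.
    by rewrite /= vE /y; case: (odd k); rewrite ?(mateK mnn).
  move=> u u' [v b]; rewrite !inE => /andP[/andP[_ /eqP mu] _] /andP[/andP[_ /eqP mu'] _].
  move=> /existsP[j /andP[al /= /eqP ->]] /existsP[j' /andP[al' /= /eqP eqx]].
  by have [] := alive_inj mu mu' al al' eqx.
have c3 : #|U3| * l <= n.
  have -> : #|U3| * l = #|setX U3 [set: 'I_l]| by rewrite cardsX cardsT card_ord.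
  apply: (@leq_trans #|[set: V]|); last by rewrite cardsT card_ord.
  apply: (@card_leq_rel _ _ _ _ (fun (p : V * 'I_l) v => v == x p.1 p.2)).
    by move=> [u i] _; exists (x u i); rewrite ?inE.
  move=> [u i] [u' i'] v; rewrite !inE !andbT /=.
  move=> /andP[/andP[_ /eqP mu] al] /andP[/andP[_ /eqP mu'] al'] /eqP -> /eqP eqx.
  have alm (w : V) (k : 'I_l) : alive w l -> alive w k.
    move=> alw; apply/forallP => j; apply/andP/(aliveP alw).
    exact: ltn_trans (ltn_ord j) (ltn_ord k).
  have [-> eqi] := alive_inj mu mu' (alm _ _ al) (alm _ _ al') eqx.
  by rewrite (ord_inj eqi).
have cm : #|unmatched m| = #|unmatched m :&: unmatched nn| + #|U| by rewrite cardsID.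
have cn : #|unmatched nn| = #|unmatched m :&: unmatched nn| + #|W|.
  by rewrite setIC cardsID.
rewrite cm cn; nia.
Qed.

End Alternating.

(** * One round of augmentation *)

Section GreedyQueries.
Variables (T : eqType) (c : rel T) (A : T -> nat) (w : nat -> T).

Lemma gfreeE i z : gfree c A predT w i z =
  ~~ has (fun j => gfree c A predT w j (w j)) [seq j <- iota 0 i | c (w j) z].
Proof.
elim: i => [|i IH] //; rewrite gfreeS IH -addn1 iotaD cats1 filter_rcons add0n.
by case: (c (w i) z); rewrite ?andbT // has_rcons negb_or andbC.
Qed.

(** The combinatorial cost is exactly that of a lazy evaluation in increasing rank, the one that
    [local_has] implements. *)
Lemma gcostE i z : gcost c A predT w i z = A z +
  lazy_cost (fun j => gcost c A predT w j (w j)) (fun j => gfree c A predT w j (w j))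
    [seq j <- iota 0 i | c (w j) z].
Proof.
elim: i => [|i IH]; first by rewrite addn0.
rewrite gcostS IH gfreeE -addn1 iotaD cats1 filter_rcons add0n -addnA.
case: (c (w i) z); rewrite ?addn0 // lazy_cost_rcons /=.
by case: (has _ _).
Qed.

End GreedyQueries.

Lemma lazy_cost_scale (I : eqType) (q q' : I -> nat) (F : pred I) s k :
  {in s, forall i, q i = k * q' i} -> lazy_cost q F s = k * lazy_cost q' F s.
Proof.
elim: s => [|i s IH] eqq /=; first by rewrite muln0.
rewrite eqq ?mem_head // IH => [|j js]; last by rewrite eqq // inE js orbT.
by case: (F i); rewrite ?addn0 ?mulnDr ?muln0.
Qed.

Section Phase.
Variables (n l D q : nat) (h : sgraph n -> sgraph n) (m : sgraph n -> 'I_n -> 'I_n).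
Local Notation V := 'I_n.
Local Notation T := (l.*2.-tuple V).
Local Notation d G := (info_of (h G) (m G)).
Hypotheses (l_gt0 : 0 < l) (leD : forall G v, #|nbrs (h G) v| <= D).
Hypothesis mm : forall G, is_mate (h G) (m G).
Hypothesis lq : forall v, local (fun _ => q) (fun G => d G v).

(** Tuples that are not augmenting are isolated. The random order can thus range over all tuples and
    be drawn before the graph is known. *)
Definition conflict (e : {ffun V -> {set V} * V}) : rel T := fun y z =>
  [&& y != z, augmenting e y, augmenting e z & has (mem y) z].

Lemma conflict_sym e : symmetric (conflict e).
Proof.
by move=> y z; rewrite /conflict eq_sym has_sym; congr (_ && _); rewrite andbCA.
Qed.

Lemma conflict_irr e : irreflexive (conflict e).
Proof. by move=> y; rewrite /conflict eqxx. Qed.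

Lemma local_ball (A : {set V}) i :
  local (fun _ => i * (#|A| * D.+1 ^ i * q)) (fun G => ball (h G) A i).
Proof.
elim: i => [|i IH]; first by rewrite mul0n; apply: local_const.
pose grow (B : {set V}) (e : {ffun V -> {set V} * V}) := B :|: \bigcup_(v in B) (e v).1.
have lg (B : {set V}) := local_map (grow B) (local_mask (fun v : V => (set0, v)) B lq).
apply: local_sub (local_bind IH lg) => G.
  have le_b := card_ball A i (leD G).
  have le_p : #|A| * D.+1 ^ i <= #|A| * D.+1 ^ i.+1.
    by rewrite leq_mul2l leq_pexp2l ?orbT.
  rewrite mulSn addnC; apply: leq_add; first by rewrite leq_mul2r (leq_trans le_b) ?orbT.
  by rewrite leq_mul2l leq_mul2r le_p !orbT.
rewrite /grow ballS; congr (_ :|: _); apply: eq_bigr => v vB.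
by rewrite !ffunE vB.
Qed.

Lemma local_view (A : {set V}) i :
  local (fun _ => i.+1 * (#|A| * D.+1 ^ i * q))
    (fun G => (ball (h G) A i, mask_info (ball (h G) A i) (d G))).
Proof.
have lg (B : {set V}) :=
  local_map (pair B) (local_mask (fun v : V => (set0, v)) B lq).
apply: local_sub (local_bind (local_ball A i) lg) => G //.
by rewrite mulSn addnC leq_add2r leq_mul2r card_ball ?orbT.
Qed.

Lemma eq_mask_info (B : {set V}) (e : {ffun V -> {set V} * V}) (z : seq V) :
  all (mem B) z -> {in z, mask_info B e =1 e}.
Proof. by move=> /allP zB v vz; rewrite ffunE; have /= -> := zB v vz. Qed.

Lemma augmenting_sub_ball G (z : T) (A : {set V}) x :
  augmenting (d G) z -> x \in z -> x \in A ->
  all (mem (ball (h G) A l.*2)) z.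
Proof.
move=> /and4P[zw _ _ _] xz xA; apply/allP => v vz.
by have := walk_sub_ball zw xz xA vz; rewrite size_tuple.
Qed.

Definition listing_cost := l.*2.+1 * (l.*2 * D.+1 ^ l.*2 * q).

Lemma local_conflicts (w : nat -> T) i z : local (fun _ => listing_cost)
  (fun G => [seq j <- iota 0 i | conflict (d G) (w j) z]).
Proof.
pose A := [set v in z].
have cA : #|A| <= l.*2 by rewrite cardsE (leq_trans (card_size _)) ?size_tuple.
pose sel (p : {set V} * {ffun V -> {set V} * V}) :=
  [seq j <- iota 0 i | all (mem p.1) (w j) && conflict p.2 (w j) z].
apply: local_sub (local_map sel (local_view A l.*2)) => [G|G].
  by rewrite leq_mul2l !leq_mul2r cA !orbT.
apply: eq_filter => j /=.
have zB : all (mem (ball (h G) A l.*2)) z.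
  apply/allP => v vz; have := sub_ball (h G) A (leq0n l.*2).
  by move/subsetP/(_ v); apply; rewrite inE.
case: (boolP (all _ (w j))) => wB /=.
  by rewrite /conflict !(eq_augmenting (eq_mask_info _ _)).
apply/esym/negbTE; apply: contra wB => /and4P[_ aw _ /hasP[x xz xw]].
by apply: augmenting_sub_ball aw xw _; rewrite inE.
Qed.

Local Notation weight G := (fun z : T => nat_of_bool (augmenting (d G) z)).
Local Notation pcost G w := (gcost (conflict (d G)) (weight G) predT w).
Local Notation pfree G w := (gfree (conflict (d G)) (weight G) predT w).

(** Each recursive call pays for one listing of conflicts. The extra summand covers a tuple that is
    not augmenting: its cost is 0, yet one listing is spent on finding that out. *)
Lemma local_gfree (w : nat -> T) i z :
  local (fun G => listing_cost * (pcost G w i z + ~~ augmenting (d G) z))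
    (fun G => pfree G w i z).
Proof.
elim/ltn_ind: i z => i IH z.
pose qj j G := listing_cost * (pcost G w j (w j) + ~~ augmenting (d G) (w j)).
pose Fj j G := pfree G w j (w j).
pose below (s : seq nat) := [seq j <- s | j < i].
(* The continuation must accept any list, but the induction hypothesis covers only indices below
   [i]; on the list actually returned the filter changes nothing. *)
have lK (s : seq nat) : local (fun G => lazy_cost (qj^~ G) (Fj^~ G) (below s))
    (fun G => ~~ has (Fj^~ G) (below s)).
  apply: (local_map negb); apply: local_has => j.
  by rewrite mem_filter => /andP[lt_ji _]; apply: IH.
have belowE G : below [seq j <- iota 0 i | conflict (d G) (w j) z] =
                [seq j <- iota 0 i | conflict (d G) (w j) z].
  by apply/all_filterP/allP => j; rewrite mem_filter mem_iota => /andP[_].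
apply: local_sub (local_bind (local_conflicts w i z) lK) => G; rewrite belowE.
  2: by rewrite -gfreeE.
rewrite gcostE (@lazy_cost_scale _ _ (fun j => pcost G w j (w j)) _ _ listing_cost); last first.
  move=> j; rewrite mem_filter => /andP[/and4P[_ aw _ _] _].
  by rewrite /qj aw addn0.
set L := lazy_cost _ _ _.
have -> : nat_of_bool (augmenting (d G) z) + L + ~~ augmenting (d G) z = L.+1.
  by case: (augmenting _ _); rewrite /= ?addn0 ?addn1 ?add1n.
by rewrite mulnS.
Qed.

Section Order.
Variables (z0 : T) (b : nat) (p : seq T).
Local Notation w := (nth z0 p).

(** The greedy decision cut off after [b] probes; [kept_set] collects the selected paths that
    survive the cut. *)
Definition selectable (z : T) : sgraph n -> bool :=
  projT1 (local_cut b (local_gfree w (index z p) z)).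

Lemma local_selectable z : local (fun _ => b) (selectable z).
Proof. exact: (projT2 (local_cut b (local_gfree w (index z p) z))).1. Qed.

Lemma selectableP z G : (selectable z G -> pfree G w (index z p) z) /\
  (pfree G w (index z p) z ->
   listing_cost * (pcost G w (index z p) z + ~~ augmenting (d G) z) <= b ->
   selectable z G).
Proof. exact: (projT2 (local_cut b (local_gfree w (index z p) z))).2. Qed.

Definition around G v : seq T := [seq z : T <- enum {: T} | augmenting (d G) z && (v \in z)].

(** When [p] orders all tuples, the surviving paths are disjoint and taking the head involves no
    choice ([chosenP]). *)
Definition chosen G v := ohead [seq z <- around G v | selectable z G].

Definition new_mate G v : V :=
  if chosen G v is Some z then rematching (d G) z v else m G v.

Lemma size_around G v : size (around G v) <= l.*2 * D.+1 ^ l.*2.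
Proof.
rewrite -[X in _ <= X]mul1n -[1]/(size [:: v]).
have -> : size (around G v) =
          #|[pred z : T | augmenting (d G) z && (v \in z)]|.
  by rewrite cardE /around enumT; congr size; apply: eq_filter => z; rewrite inE.
apply: (card_walks_hitting (leD G) (m := m G)) => z /andP[/and4P[zw _ _ _] vz].
by rewrite /= vz.
Qed.

Lemma local_new_mate v :
  local (fun _ => listing_cost + l.*2 * D.+1 ^ l.*2 * b)
    (fun G => info_of (h G) (new_mate G) v).
Proof.
pose cands (e : {set V} * {ffun V -> {set V} * V}) :=
  [seq z : T <- enum {: T} | all (mem e.1) z && augmenting e.2 z && (v \in z)].
pose final (e : {set V} * {ffun V -> {set V} * V}) (s : seq bool) :=
  ((e.2 v).1, if ohead (mask s (cands e)) is Some z then rematching e.2 z v else (e.2 v).2).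
have lK e := local_map (final e) (local_seq (cands e) local_selectable).
have candsE G : cands (ball (h G) [set v] l.*2, mask_info (ball (h G) [set v] l.*2) (d G)) =
    around G v.
  apply: eq_filter => z /=.
  case: (boolP (all _ z)) => zB /=; first by rewrite (eq_augmenting (eq_mask_info _ zB)).
  apply/esym/negbTE; apply: contra zB => /andP[az vz].
  by apply: augmenting_sub_ball az vz _; rewrite inE.
apply: local_sub (local_bind (local_view [set v] l.*2) lK) => G; rewrite candsE.
  rewrite leq_add // ?leq_mul2r ?size_around ?orbT // cards1 mul1n leq_mul2l leq_mul2r.
  by rewrite leq_pmull ?orbT // double_gt0.
have vB : v \in ball (h G) [set v] l.*2.
  by apply: (subsetP (sub_ball (h G) [set v] (leq0n l.*2))); rewrite inE.
rewrite /final candsE -filter_mask -/(chosen G v) /= !ffunE vB /= /new_mate.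
congr (_, _); case E: (chosen G v) => [z|] //.
have : z \in around G v.
  have : z \in [seq z <- around G v | selectable z G].
    by move: E; rewrite /chosen; case: (filter _ _) => //= y s [->]; rewrite mem_head.
  by rewrite mem_filter => /andP[].
rewrite mem_filter => /andP[/andP[az vz] _].
have zB := augmenting_sub_ball az vz (set11 v).
by rewrite (eq_rematching (eq_mask_info _ zB)).
Qed.

Hypothesis p_perm : p \in permutations (enum {: T}).

Let p_uniq : uniq p.
Proof. by have := p_perm; rewrite mem_permutations => /perm_uniq ->; rewrite enum_uniq. Qed.

Let p_all z : z \in p.
Proof. by have := p_perm; rewrite mem_permutations => /perm_mem ->; rewrite mem_enum. Qed.

Definition greedy_set G := [set z : T | augmenting (d G) z && pfree G w (index z p) z].
Definition kept_set G := [set z : T | augmenting (d G) z && selectable z G].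

Lemma kept_sub G : kept_set G \subset greedy_set G.
Proof.
apply/subsetP => z; rewrite !inE => /andP[-> /=].
by have [+ _] := selectableP z G; apply.
Qed.

Lemma greedy_independent G (y z : T) x : y \in greedy_set G -> z \in greedy_set G ->
  x \in y -> x \in z -> y = z.
Proof.
rewrite !inE => /andP[ay fy] /andP[az fz] xy xz; apply/eqP/negPn/negP => neq.
wlog lt_i : y z ay fy az fz xy xz neq / index y p < index z p.
  move=> wl; have [lt_i|lt_i|eq_i] := ltngtP (index y p) (index z p).
  - exact: (wl y z).
  - by apply: (wl z y) => //; rewrite eq_sym.
  - by case/eqP: neq; rewrite -(nth_index z0 (p_all y)) eq_i nth_index.
have cyz : conflict (d G) y z by rewrite /conflict neq ay az; apply/hasP; exists x.
move: fz; rewrite gfreeE => /hasPn/(_ (index y p)).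
by rewrite mem_filter mem_iota add0n lt_i nth_index // cyz fy => /(_ isT).
Qed.

Lemma greedy_maximal G (z : T) : augmenting (d G) z ->
  exists2 y, y \in greedy_set G & exists2 x, x \in y & x \in z.
Proof.
move=> az; case: (boolP (pfree G w (index z p) z)) => [fz|].
  exists z; first by rewrite inE az.
  by case/and4P: az => _ _ /hasP[x xz _] _; exists x.
rewrite gfreeE negbK => /hasP[j]; rewrite mem_filter mem_iota add0n.
move=> /andP[/and4P[_ aw _ /hasP[x xz xw]] /andP[_ lt_j]] fw.
have lt_p : j < size p by apply: ltn_trans lt_j _; rewrite index_mem.
by exists (w j); [rewrite inE aw index_uniq | exists x].
Qed.

Lemma chosenP G v (z : T) : z \in kept_set G -> v \in z -> chosen G v = Some z.
Proof.
move=> zk vz; have : z \in [seq z <- around G v | selectable z G].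
  by move: zk; rewrite inE mem_filter mem_filter mem_enum vz => /andP[-> ->].
rewrite /chosen; case E: (filter _ _) => [|y s] // _ /=; congr Some.
have : y \in [seq z <- around G v | selectable z G] by rewrite E mem_head.
rewrite mem_filter mem_filter => /andP[sy /andP[/andP[ay vy] _]].
apply: (greedy_independent (G := G)) vy vz; apply: (subsetP (kept_sub G)) => //.
by rewrite inE ay sy.
Qed.

Lemma chosen_none G v : (forall z, z \in kept_set G -> v \notin z) -> chosen G v = None.
Proof.
move=> no; rewrite /chosen; case E: (filter _ _) => [|y s] //=.
have : y \in [seq z <- around G v | selectable z G] by rewrite E mem_head.
rewrite mem_filter mem_filter => /andP[sy /andP[/andP[ay vy] _]].
by move: (no y); rewrite inE ay sy vy => /(_ isT).
Qed.

Lemma keptVnone G v : (exists2 z, z \in kept_set G & v \in z) \/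
  (forall z, z \in kept_set G -> v \notin z).
Proof.
have [/existsP[z /andP[zk vz]]|no] := boolP [exists z : T, (z \in kept_set G) && (v \in z)].
  by left; exists z.
by right=> z zk; move/existsPn/(_ z): no; rewrite zk.
Qed.

Lemma new_mate_rematch G (z : T) v : z \in kept_set G -> v \in z ->
  [/\ new_mate G v \in z, new_mate G (new_mate G v) = v & adj (h G) v (new_mate G v)].
Proof.
move=> zk vz; have : augmenting (d G) z by move: zk; rewrite inE => /andP[].
move/rematchingP/allP => rz; have /and3P[rvz /eqP rr] := rz v vz.
rewrite ffunE inE => av.
have eqv u : u \in z -> new_mate G u = rematching (d G) z u.
  by move=> uz; rewrite /new_mate (chosenP zk uz).
by rewrite !(eqv v vz) (eqv _ rvz).
Qed.

(** A kept path is closed under the old matching, so the vertices off the kept paths have their old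
    mates off them too. *)
Lemma is_mate_new_mate G : is_mate (h G) (new_mate G).
Proof.
move=> v; have [[z zk vz]|no] := keptVnone G v.
  by have [_ ? ?] := new_mate_rematch zk vz.
have mv : new_mate G v = m G v by rewrite /new_mate chosen_none.
have [mmv amv] := mm G v; rewrite mv; split=> //.
rewrite /new_mate chosen_none // => z zk; apply: contra (no z zk) => mvz.
have : augmenting (d G) z by move: zk; rewrite inE => /andP[].
by case/and4P => _ /allP/(_ _ mvz) + _ _; rewrite ffunE /= mmv.
Qed.

(** Every kept path owns a vertex that was unmatched, and leaves none of its vertices unmatched. *)
Lemma unmatched_new_mate G : #|unmatched (new_mate G)| + #|kept_set G| <= #|unmatched (m G)|.
Proof.
pose Y := [set v in unmatched (m G) | [exists z in kept_set G, v \in z]].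
have cY : #|kept_set G| <= #|Y|.
  apply: (@card_leq_rel _ _ _ _ (fun (z : T) v => v \in z)) => [z zk|z z' v zk z'k vz vz'].
    have : augmenting (d G) z by move: zk; rewrite inE => /andP[].
    case/and4P => _ _ /hasP[v vz +] _; rewrite ffunE /= => mv.
    by exists v => //; rewrite !inE mv; apply/existsP; exists z; rewrite zk.
  by apply: (greedy_independent (G := G)) vz vz'; apply: (subsetP (kept_sub G)).
apply: (leq_trans (leq_add (leqnn _) cY)).
have <- : #|unmatched (new_mate G) :|: Y| = #|unmatched (new_mate G)| + #|Y|.
  suff YI : unmatched (new_mate G) :&: Y = set0 by rewrite cardsU YI cards0 subn0.
  apply/setP => v; rewrite !inE; apply/negP => /and3P[nv _ /existsP[z /andP[zk vz]]].
  have [_ _] := new_mate_rematch zk vz.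
  by rewrite (eqP nv) adj_irr.
apply: subset_leq_card; apply/subsetP => v; rewrite in_setU => /orP[|]; last first.
  by rewrite !inE => /andP[].
rewrite !inE => nv; have [[z zk vz]|no] := keptVnone G v.
  by have [_ _] := new_mate_rematch zk vz; rewrite (eqP nv) adj_irr.
by move: nv; rewrite /new_mate chosen_none.
Qed.

(** By maximality every augmenting tuple meets a selected one, so the vertices of the selected
    tuples, at most [2 l] for each, form the hitting set of [unmatched_leq]. *)
Lemma unmatched_greedy G nn : is_mate (h G) nn ->
  l * #|unmatched (m G)| <=
  l * #|unmatched nn| + 4 * l ^ 2 * #|greedy_set G| + n.
Proof.
move=> mnn; pose X := \bigcup_(z in greedy_set G) [set v in z].
have cX : #|X| <= #|greedy_set G| * l.*2.
  apply: card_bigcup_leq => z _.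
  by rewrite cardsE (leq_trans (card_size _)) ?size_tuple.
have XP (z : T) : augmenting (d G) z -> exists2 v, v \in X & v \in z.
  move=> /greedy_maximal[y yg [x xy xz]]; exists x => //.
  by apply/bigcupP; exists y => //; rewrite inE.
apply: (leq_trans (unmatched_leq (mm G) mnn l_gt0 XP)).
rewrite leq_add2r leq_add2l -mulnA.
apply: (@leq_trans (l * (2 * (#|greedy_set G| * l.*2)))).
  by rewrite leq_mul2l leq_mul2l cX !orbT.
by move: #|_| => g; rewrite -muln2; nia.
Qed.

(** Markov's inequality: a dropped path needed more than [B0] calls, and all of them are counted in
    the total. *)
Lemma dropped_leq G B0 : b = listing_cost * B0 ->
  #|greedy_set G :\: kept_set G| * B0 <=
  greedy_total (conflict (d G)) (weight G) predT z0 p.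
Proof.
move=> bE; pose P := [pred z | z \in greedy_set G :\: kept_set G].
apply: (@leq_trans (\sum_(z <- p | P z) pcost G w (index z p) z)).
  have -> : #|greedy_set G :\: kept_set G| * B0 = \sum_(z <- p | P z) B0.
    rewrite (perm_big (enum {: T})) /=; last by rewrite -mem_permutations.
    by rewrite big_enum_cond /= sum_nat_const; congr (_ * _); apply: eq_card => z; rewrite !inE.
  apply: leq_sum => z; rewrite !inE => /andP[nk /andP[az fz]].
  rewrite az /= in nk; rewrite leqNgt; apply: contra nk => lt_B.
  have [_] := selectableP z G; apply=> //.
  by rewrite az addn0 bE leq_mul2l (ltnW lt_B) orbT.
rewrite /greedy_total big_mkcond (big_nth z0) big_mkord.
apply: leq_sum => i _; rewrite index_uniq //.
by case: ifP.
Qed.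

End Order.
End Phase.

(** * Average gain and worst-case cost of a round *)

Section PhaseAverage.
Variables (n l D q : nat) (h : sgraph n -> sgraph n) (m : sgraph n -> 'I_n -> 'I_n).
Local Notation V := 'I_n.
Local Notation T := (l.*2.-tuple V).
Local Notation d G := (info_of (h G) (m G)).
Hypotheses (l_gt0 : 0 < l) (leD : forall G v, #|nbrs (h G) v| <= D).
Hypothesis mm : forall G, is_mate (h G) (m G).
Hypothesis lq : forall v, local (fun _ => q) (fun G => d G v).
Local Notation weight G := (fun z : T => nat_of_bool (augmenting (d G) z)).

Definition walk_count := l.*2 * D.+1 ^ l.*2.
(** The threshold for Markov's inequality, chosen so that the expected number of dropped paths is at
    most [n / (4 l ^ 2)]. *)
Definition call_bound := 4 * l ^ 2 * walk_count * (2 + l.*2 * walk_count).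

Lemma sum_weight G : \sum_(z <- enum {: T}) weight G z <= n * walk_count.
Proof.
have -> : \sum_(z <- enum {: T}) weight G z = #|[pred z : T | augmenting (d G) z]|.
  rewrite big_enum -sum1_card [RHS]big_mkcond; exact: eq_big.
rewrite -[X in X * _](size_enum_ord n).
apply: (card_walks_hitting (leD G) (m := m G)) => z /and4P[zw _ /hasP[v vz _] _].
by split=> //; apply/hasP; exists v; rewrite // mem_enum.
Qed.

Lemma pairs_weight G : pairs (conflict (d G)) (weight G) predT (enum {: T}) <=
  n * walk_count * (l.*2 * walk_count).
Proof.
apply: (@leq_trans (\sum_(z <- enum {: T}) weight G z * (l.*2 * walk_count))); last first.
  by rewrite -big_distrl /= leq_mul2r sum_weight orbT.
apply: leq_sum => z _.
have -> : \sum_(y <- enum {: T}) (if conflict (d G) z y && predT y then weight G z else 0) =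
          weight G z * #|[pred y : T | conflict (d G) z y]|.
  rewrite big_enum -big_mkcond /= sum_nat_const mulnC; congr (_ * _).
  by apply: eq_card => y; rewrite -!topredE /= andbT.
rewrite leq_mul2l; apply/orP; right.
rewrite -[X in X * _](size_tuple z).
apply: (card_walks_hitting (leD G) (m := m G)) => y /and4P[_ _ /and4P[yw _ _ _]].
by rewrite has_sym => /hasP[x xy xz]; split=> //; apply/hasP; exists x.
Qed.

(** One [n] in the error comes from the alternating walks that are too long, the other from the
    dropped paths. *)
Lemma sum_new_mate z0 G nn b (ps : seq (seq T)) : is_mate (h G) nn ->
  b = listing_cost l D q * call_bound -> ps = permutations (enum {: T}) ->
  \sum_(p <- ps) 4 * l ^ 2 * #|unmatched (new_mate leD lq z0 b p G)| +
    size ps * (l * #|unmatched (m G)|) <=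
  size ps * (l * #|unmatched nn| + 4 * l ^ 2 * #|unmatched (m G)| + 2 * n).
Proof.
move=> mnn bE psE.
pose drop p := #|greedy_set h m z0 p G :\: kept_set leD lq z0 b p G|.
have each p : p \in permutations (enum {: T}) -> l * #|unmatched (m G)| +
    4 * l ^ 2 * #|unmatched (new_mate leD lq z0 b p G)| <=
    l * #|unmatched nn| + 4 * l ^ 2 * #|unmatched (m G)| + n + 4 * l ^ 2 * drop p.
  move=> pp; have ug := unmatched_greedy l_gt0 mm z0 pp mnn.
  have un := unmatched_new_mate leD lq z0 b pp G.
  have ks := kept_sub leD lq z0 b p G.
  have cg : #|greedy_set h m z0 p G| = #|kept_set leD lq z0 b p G| + drop p.
    by rewrite -(cardsID (kept_set leD lq z0 b p G)) (setIidPr ks).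
  move: ug un; rewrite cg; set a := #|unmatched (m G)|; set a' := #|unmatched nn|.
  set a2 := #|unmatched _|; set k := #|kept_set _ _ _ _ _ _|; set dr := drop p; nia.
have total : (\sum_(p <- ps) drop p) * (2 * call_bound) <=
    size ps * (n * walk_count * (2 + l.*2 * walk_count)).
  apply: (@leq_trans (\sum_(p <- ps)
      2 * greedy_total (conflict (d G)) (weight G) predT z0 p)).
    rewrite big_distrl /= big_seq [leqRHS]big_seq; apply: leq_sum => p; rewrite psE => pp.
    have := dropped_leq leD lq z0 pp G bE.
    by rewrite -/(drop p) mulnCA leq_mul2l => ->; rewrite orbT.
  have := greedy_expected_cost (@conflict_sym n l (d G)) (@conflict_irr n l (d G))
    (weight G) predT z0 (enum_uniq {: T}).
  rewrite -psE; move/leq_trans; apply; rewrite psE size_permutations ?enum_uniq // leq_mul2l.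
  apply/orP; right; rewrite mulnDr; apply: leq_add; last exact: pairs_weight.
  by rewrite mulnC leq_mul2r sum_weight orbT.
have small : 4 * l ^ 2 * (\sum_(p <- ps) drop p) <= size ps * n.
  have wc_gt0 : 0 < walk_count by rewrite muln_gt0 double_gt0 l_gt0 expn_gt0.
  have pos : 0 < 2 * (walk_count * (2 + l.*2 * walk_count)).
    by move: wc_gt0; set W := walk_count; lia.
  rewrite -(leq_pmul2r pos); move: total; rewrite /call_bound.
  set S := \sum_(p <- ps) drop p; set W := walk_count; set Z := 2 + _; set P := size ps.
  move=> le; apply: (@leq_trans (P * (n * W * Z))).
    apply: leq_trans le; apply: eq_leq; lia.
  lia.
rewrite addnC; apply: (@leq_trans (\sum_(p <- ps)
  (l * #|unmatched nn| + 4 * l ^ 2 * #|unmatched (m G)| + n + 4 * l ^ 2 * drop p))).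
  rewrite -[size ps]sum1_size big_distrl /= -big_split /=.
  rewrite big_seq [leqRHS]big_seq; apply: leq_sum => p; rewrite psE => pp.
  by rewrite mul1n each.
rewrite big_split /= -big_distrr /= big_const_seq count_predT iter_addn_0.
by move: small; set S := \sum_(p <- ps) drop p; set P := size ps; lia.
Qed.

(** All factors are compared with powers of [L = D.+1 ^ l.*2], which exceeds [l.*2] and is at least
    4. The product is at most [L ^ 14], hence the exponent [28 * l]. *)
Lemma phase_cost_leq : 0 < D ->
  listing_cost l D q + walk_count * (listing_cost l D q * call_bound) <=
  D.+1 ^ (28 * l) * q.
Proof.
move=> D_gt0; set L := D.+1 ^ l.*2.
have le_l : l.*2 < L.
  by apply: leq_trans (ltn_expl _ (isT : 1 < 2)) _; rewrite leq_exp2r ?double_gt0.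
have L4 : 4 <= L.
  apply: (@leq_trans (2 ^ 2)) => //; apply: (@leq_trans (D.+1 ^ 2)).
    by rewrite leq_exp2r.
  by rewrite leq_pexp2l // -muln2; lia.
have -> : D.+1 ^ (28 * l) = L ^ 14 by rewrite /L -expnM -muln2; congr (_ ^ _); lia.
have leW : walk_count <= L ^ 2 by rewrite /walk_count -/L -mulnn leq_mul2r (ltnW le_l) orbT.
have leZ : 2 + l.*2 * walk_count <= L ^ 4.
  apply: (@leq_trans (2 + L ^ 3)).
    by rewrite leq_add2l (expnS _ 2); apply: leq_mul => //; apply: ltnW.
  rewrite (expnS _ 3); have : L <= L ^ 3 by rewrite -{1}(expn1 L) leq_pexp2l // (leq_trans _ L4).
  by move: L4; set a := L ^ 3; nia.
have leB : call_bound <= L ^ 8.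
  have -> : L ^ 8 = L ^ 2 * L ^ 2 * L ^ 4 by rewrite -!expnD.
  apply: (leq_mul (leq_mul _ leW) leZ).
  have -> : 4 * l ^ 2 = l.*2 ^ 2 by rewrite -!muln2 expnMn mulnC.
  by rewrite leq_exp2r // ltnW.
have leC : 1 + walk_count * call_bound <= L ^ 11.
  apply: (@leq_trans (1 + L ^ 10)).
    by rewrite leq_add2l -[10]/(2 + 8) expnD leq_mul.
  rewrite (expnS _ 10); have : 0 < L ^ 10 by rewrite expn_gt0 (leq_trans _ L4).
  by move: L4; set a := L ^ 10; nia.
have -> : listing_cost l D q + walk_count * (listing_cost l D q * call_bound) =
  l.*2.+1 * walk_count * (1 + walk_count * call_bound) * q.
  by rewrite /listing_cost -/walk_count; nia.
rewrite leq_mul2r; apply/orP; right.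
have -> : L ^ 14 = L * L ^ 2 * L ^ 11 by rewrite -expnS -expnD.
apply: leq_mul => //.
exact: leq_mul.
Qed.

Lemma phase : 0 < D ->
  {m' : seq T -> sgraph n -> V -> V &
    ((forall p v, local (fun _ => D.+1 ^ (28 * l) * q)%N (fun G => info_of (h G) (m' p G) v)) *
     (forall p G, p \in permutations (enum {: T}) -> is_mate (h G) (m' p G)) *
     (forall G nn, is_mate (h G) nn ->
       (\sum_(p <- permutations (enum {: T})) 4 * l ^ 2 * #|unmatched (m' p G)| +
         size (permutations (enum {: T})) * (l * #|unmatched (m G)|) <=
       size (permutations (enum {: T})) *
         (l * #|unmatched nn| + 4 * l ^ 2 * #|unmatched (m G)| + 2 * n))%N))%type}.
Proof.
(* The tuple [z0] is only a default for [nth]. If there is no tuple then [n = 0], and the old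
   matching is kept. *)
move=> D_gt0; case: (pickP (predT : pred T)) => [z0 _|noT].
  exists (fun p => new_mate leD lq z0 (listing_cost l D q * call_bound) p).
  split; [split|] => [p v|p G pp|G nn mnn].
  - by apply: local_sub (local_new_mate l_gt0 leD lq z0 _ p v) => // G; apply: phase_cost_leq.
  - exact: is_mate_new_mate.
  - exact: sum_new_mate.
have n0 : n = 0.
  case: n h m leD mm lq noT => // n' h' m' leD' mm' lq' /(_ [tuple ord0 | _ < l.*2]).
  by [].
exists (fun _ => m); split; [split|] => [p v|p G _|G nn mnn].
- by apply: local_sub (lq v) => // G; rewrite leq_pmull // expn_gt0.
- exact: mm.
- have un : #|unmatched (m G)| = 0.
    by apply/eqP; rewrite -leqn0 (leq_trans (max_card _)) // card_ord n0.
  by rewrite un !muln0 big1_eq.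
Qed.

End PhaseAverage.

(** * Iterating the rounds *)

Definition phase_len (j : nat) : nat := (j %/ 8).+1.

Definition phase_orders n j : seq (seq ((phase_len j).*2.-tuple 'I_n)) :=
  permutations (enum {: (phase_len j).*2.-tuple 'I_n}).

(** Every round draws a fresh order of the tuples, as an index into the list of all permutations. *)
Fixpoint phase_seed (n j : nat) : finType :=
  if j is j'.+1 then (phase_seed n j' * 'I_(size (phase_orders n j')))%type else unit.

Lemma phase_orders_gt0 n j : 0 < size (phase_orders n j).
Proof. by rewrite size_permutations ?enum_uniq // fact_gt0. Qed.

Lemma card_phase_seed_gt0 n j : 0 < #|phase_seed n j|.
Proof.
elim: j => [|j IH]; first by rewrite card_unit.
by rewrite card_prod card_ord muln_gt0 IH phase_orders_gt0.
Qed.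

Section Numeric.
Local Open Scope ring_scope.
Variable R : realFieldType.

(* The gap after [j] phases is [128 n / (j + 8)]; the schedule
   [8 l <= j + 8 <= 16 l] balances the progress [1 / 4l] of a phase against its
   error [1 / 2l^2]. *)
Lemma gap_step (j : nat) (l : R) : l = (phase_len j)%:R ->
  128 / (j + 8)%:R * (1 - 1 / (4 * l)) + 1 / (2 * l ^+ 2) <= 128 / (j + 9)%:R.
Proof.
move=> lE; pose y : R := (j + 8)%:R.
have yE : (j + 9)%:R = y + 1 by rewrite /y -[X in _ = _ + X]/(1%:R) -natrD -addnA.
have l1 : 1 <= l by rewrite lE ler1n.
have le1 : 8 * l <= y by rewrite lE -natrM ler_nat /phase_len; lia.
have le2 : y <= 16 * l by rewrite lE -natrM ler_nat /phase_len; lia.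
have y_gt0 : 0 < y by lra.
have l_gt0 : 0 < l by lra.
rewrite -/y yE; clearbody y => {yE}.
(* With [1 / 4l >= 2 / y] and [1 / 2l^2 <= 128 / y^2], the new gap is at most [128 / y - 128 / y^2],
   which is below [128 / (y + 1)]. *)
have e1 : 2 / y <= 1 / (4 * l).
  by rewrite ler_pdivrMr // mulrAC ler_pdivlMr; lra.
have e2 : 1 / (2 * l ^+ 2) <= 128 / y ^+ 2.
  rewrite ler_pdivrMr ?mulr_gt0 ?exprn_gt0 // mulrAC ler_pdivlMr ?exprn_gt0 //.
  by nra.
have e3 : 128 / y * (1 - 1 / (4 * l)) <= 128 / y * (1 - 2 / y).
  by apply: ler_wpM2l; [rewrite divr_ge0 // ltW | lra].
have e4 : 128 / y * (1 - 2 / y) + 128 / y ^+ 2 <= 128 / (y + 1).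
  rewrite ler_pdivlMr; last by lra.
  have -> : (128 / y * (1 - 2 / y) + 128 / y ^+ 2) * (y + 1) = 128 * (1 - (y ^+ 2)^-1).
    by field; rewrite gt_eqF.
  have : 0 < (y ^+ 2)^-1 by rewrite invr_gt0 exprn_gt0.
  lra.
lra.
Qed.

(** In terms of the gap [u - u'], a round contracts by [1 - 1 / 4l] and adds an error [n / 2l^2]. *)
Lemma phase_real (P l u u' s n : R) : 0 < l ->
  4 * l ^+ 2 * s + P * (l * u) <= P * (l * u' + 4 * l ^+ 2 * u + 2 * n) ->
  s <= P * ((1 - 1 / (4 * l)) * u + u' / (4 * l) + n / (2 * l ^+ 2)).
Proof.
move=> l_gt0 le; have l2 : 0 < 4 * l ^+ 2 by rewrite mulr_gt0 ?exprn_gt0.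
rewrite -(ler_pM2l l2).
have -> : 4 * l ^+ 2 * (P * ((1 - 1 / (4 * l)) * u + u' / (4 * l) + n / (2 * l ^+ 2))) =
  P * (l * u' + 4 * l ^+ 2 * u + 2 * n) - P * (l * u).
  by field; rewrite gt_eqF.
lra.
Qed.

End Numeric.

Section Iteration.
Variables (R : realFieldType) (n D q : nat) (h : sgraph n -> sgraph n).
Hypotheses (D_gt0 : 0 < D) (leD : forall G v, #|nbrs (h G) v| <= D).
Hypothesis lh : forall v, local (fun _ => q) (fun G => nbrs (h G) v).

Definition iter_cost j := D.+1 ^ (28 * \sum_(i < j) phase_len i) * q.

(** The matching [nn] to compare with is quantified after the algorithm: it is known to the analysis
    only and stays the same through all rounds. *)
Definition matcher j : Type :=
  {m : phase_seed n j -> sgraph n -> 'I_n -> 'I_n &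
    ((forall w v, local (fun _ => iter_cost j) (fun G => info_of (h G) (m w G) v)) *
     (forall w G, is_mate (h G) (m w G)) *
     (forall G nn, is_mate (h G) nn ->
       (\sum_(w : phase_seed n j) (#|unmatched (m w G)|%:R : R) <=
        #|phase_seed n j|%:R * (#|unmatched nn|%:R + n%:R * (128 / (j + 8)%:R)))%R))%type}.

(** The gap allowed at the start is [16 n], so the empty matching qualifies. *)
Lemma matcher0 : matcher 0.
Proof.
exists (fun _ _ v => v); split; [split|] => [w v|w G v|G nn _].
- apply: local_sub (local_map (fun N => (N, v)) (lh v)) => G.
    by rewrite /iter_cost big_ord0 muln0 mul1n.
  by rewrite ffunE.
- by split; rewrite // eqxx.
rewrite sumr_const card_unit mulr1n mul1r.
have -> : unmatched (fun v : 'I_n => v) = [set: 'I_n] by apply/setP => v; rewrite !inE eqxx.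
rewrite cardsT card_ord; apply: (@le_trans _ _ (n%:R * (128 / (0 + 8)%:R))%R); last first.
  by rewrite lerDr ler0n.
rewrite ler_peMr ?ler0n // add0n ler_pdivlMr ?ltr0n // mul1r.
by rewrite ler_nat.
Qed.

Lemma matcherS j : matcher j -> matcher j.+1.
Proof.
move=> [m [[lm mm] avg]].
have ph w := phase (isT : 0 < phase_len j) leD (mm w) (lm w) D_gt0.
pose m' (w : phase_seed n j.+1) := projT1 (ph w.1) (nth [::] (phase_orders n j) w.2).
exists m'; split; [split|] => [w v|w G|G nn mnn].
- have [[lw _] _] := projT2 (ph w.1).
  apply: local_sub (lw (nth [::] (phase_orders n j) w.2) v) => // _.
  by rewrite /iter_cost big_ord_recr /= mulnDr expnD mulnA [_ ^ _ * _ ^ _]mulnC.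
- have [[_ mw] _] := projT2 (ph w.1).
  by apply: mw; apply: mem_nth.
pose P := size (phase_orders n j).
pose l : R := (phase_len j)%:R%R.
have l_gt0 : (0 < l)%R by rewrite ltr0n.
pose u w : R := #|unmatched (m w G)|%:R%R.
pose u' : R := #|unmatched nn|%:R%R.
have each w : (\sum_(i < P) (#|unmatched (m' (w, i) G)|%:R : R) <=
    P%:R * ((1 - 1 / (4 * l)) * u w + u' / (4 * l) + n%:R / (2 * l ^+ 2)))%R.
  apply: phase_real => //.
  have [_ /(_ G nn mnn)] := projT2 (ph w).
  rewrite -(ler_nat R) natrD natr_sum (big_nth [::]) big_mkord.
  rewrite !(natrX, natrD, natrM) -/l -/(u w) -/u' => le.
  apply: le_trans le; rewrite lerD2r mulr_sumr.
  by apply: ler_sum => i _; rewrite !(natrX, natrM).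
have -> : (\sum_(w : phase_seed n j.+1) (#|unmatched (m' w G)|%:R : R) =
   \sum_(w : phase_seed n j) \sum_(i < P) #|unmatched (m' (w, i) G)|%:R)%R.
  by rewrite pair_bigA /=; apply: eq_bigr => -[].
apply: (le_trans (ler_sum _ (fun w _ => each w))).
rewrite -mulr_sumr card_prod card_ord natrM -/P [X in (_ <= X * _)%R]mulrC -mulrA.
apply: ler_wpM2l; first by rewrite ler0n.
set W : R := #|phase_seed n j|%:R%R.
have -> : (\sum_w ((1 - 1 / (4 * l)) * u w + u' / (4 * l) + n%:R / (2 * l ^+ 2)) =
  (1 - 1 / (4 * l)) * (\sum_w u w) + W * (u' / (4 * l)) + W * (n%:R / (2 * l ^+ 2)))%R.
  set a := (u' / _)%R; set b := (n%:R / _)%R.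
  by rewrite !big_split /= -mulr_sumr !sumr_const -(mulr_natl a) -(mulr_natl b).
have gap := gap_step (erefl l).
have co : (0 <= 1 - 1 / (4 * l))%R.
  have l1 : (1 <= l)%R by rewrite ler1n.
  by rewrite subr_ge0 ler_pdivrMr; lra.
have le1 := ler_wpM2l co (avg G nn mnn).
apply: (@le_trans _ _ ((1 - 1 / (4 * l)) * (W * (u' + n%:R * (128 / (j + 8)%:R))) +
  W * (u' / (4 * l)) + W * (n%:R / (2 * l ^+ 2)))%R); first by rewrite !lerD2r.
have -> : ((1 - 1 / (4 * l)) * (W * (u' + n%:R * (128 / (j + 8)%:R))) +
  W * (u' / (4 * l)) + W * (n%:R / (2 * l ^+ 2)) =
  W * (u' + n%:R * (128 / (j + 8)%:R * (1 - 1 / (4 * l)) + 1 / (2 * l ^+ 2))))%R.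
  have y_gt0 : (0 < (j + 8)%:R :> R)%R by rewrite ltr0n addn_gt0 orbT.
  move: (_%:R)%R y_gt0 => y y_gt0; field.
  by rewrite !gt_eqF.
apply: ler_wpM2l; first by rewrite ler0n.
rewrite lerD2l; apply: ler_wpM2l; first by rewrite ler0n.
by rewrite addSnnS.
Qed.

Theorem matcher_exists j : matcher j.
Proof. by elim: j => [|j]; [exact: matcher0 | exact: matcherS]. Qed.

End Iteration.

(** * Koenig's theorem *)

Section Konig.
Variables (n : nat) (H : sgraph n) (side : pred 'I_n).
Local Notation V := 'I_n.
Hypothesis bip : forall u v, adj H u v -> side u != side v.

(** An edge followed by a matching edge, taken as one step so that paths remain on one side of the
    bipartition. *)
Definition alt_step (m : V -> V) : rel V := fun a a' =>
  [exists b, [&& adj H a b, m b == a' & m b != b]].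

Lemma alt_step_side m a a' : is_mate H m -> side a -> alt_step m a a' -> side a'.
Proof.
move=> mm sa /existsP[b /and3P[/bip + /eqP <- nb]].
have := bip (mate_adj mm nb); rewrite sa.
by case: (side b); case: (side (m b)).
Qed.

Lemma path_sub_side (e e' : rel V) a p : side a ->
  (forall x x', side x -> x' \in p -> e x x' -> e' x x' /\ side x') ->
  path e a p -> path e' a p /\ side (last a p).
Proof.
elim: p a => [|x p IH] a sa sub //= /andP[eax pth].
have [e'ax sx] := sub a x sa (mem_head _ _) eax.
have [|//] := IH x sx _ pth; last by rewrite e'ax.
by move=> y y' sy y'p; apply: sub => //; rewrite inE y'p orbT.
Qed.

Lemma augment_edge m a b : is_mate H m -> adj H a b -> m a = a -> m b = b ->
  exists2 m', is_mate H m' & #|unmatched m'| < #|unmatched m|.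
Proof.
move=> mm ab ma mb; have nab : b != a by apply: contraTneq ab => ->; rewrite adj_irr.
pose m' v := if v == a then b else if v == b then a else m v.
have m'v v : v != a -> v != b -> m' v = m v by rewrite /m' => /negbTE-> /negbTE->.
have m'a : m' a = b by rewrite /m' eqxx.
have m'b : m' b = a by rewrite /m' eqxx (negbTE nab).
exists m'.
  move=> v; have [->|va] := eqVneq v a; first by rewrite m'a m'b.
  have [->|vb] := eqVneq v b; first by rewrite m'b m'a adj_sym.
  have [mmv amv] := mm v; rewrite m'v // m'v //.
    by apply: contra va => /eqP mva; rewrite -mmv mva ma.
  by apply: contra vb => /eqP mvb; rewrite -mmv mvb mb.
apply: proper_card; apply/properP; split; last first.
  by exists a; rewrite !inE ?ma ?m'a ?eqxx // (negbTE nab).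
apply/subsetP => v; rewrite !inE.
have [->|va] := eqVneq v a; first by rewrite m'a (negbTE nab).
have [->|vb] := eqVneq v b; first by rewrite m'b eq_sym (negbTE nab).
by rewrite m'v.
Qed.

(** Switching the first two edges moves the unmatched end from [a0] to [a1] without increasing the
    number of unmatched vertices, and leaves a shorter path. Uniqueness and the bipartition ensure
    that the rest of the path is unaffected. *)
Lemma augment_path p m a0 b : is_mate H m -> side a0 -> m a0 = a0 ->
  path (alt_step m) a0 p -> uniq (a0 :: p) -> adj H (last a0 p) b -> m b = b ->
  exists2 m', is_mate H m' & #|unmatched m'| < #|unmatched m|.
Proof.
elim: p m a0 => [|a1 p IH] m a0 mm sa0 ma0.
  by move=> _ _ ab mb; apply: augment_edge ab ma0 mb.
move=> /= /andP[st pth] /and3P[na0 na1 up] lb mb.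
have sa1 := alt_step_side mm sa0 st.
case/existsP: st => b1 /and3P[a0b1 /eqP mb1 nb1].
have ma1 : m a1 = b1 by rewrite -mb1 (mateK mm).
have n01 : a1 != a0 by move: na0; rewrite inE negb_or eq_sym => /andP[].
have nb0 : b1 != a0 by apply: contraTneq a0b1 => ->; rewrite adj_irr.
have nb1' : a1 != b1 by rewrite -mb1.
pose m1 v := if v == a0 then b1 else if v == b1 then a0 else if v == a1 then a1 else m v.
have m1v v : v != a0 -> v != b1 -> v != a1 -> m1 v = m v.
  by rewrite /m1 => /negbTE-> /negbTE-> /negbTE->.
have m1a0 : m1 a0 = b1 by rewrite /m1 eqxx.
have m1b1 : m1 b1 = a0 by rewrite /m1 eqxx (negbTE nb0).
have m1a1 : m1 a1 = a1 by rewrite /m1 eqxx (negbTE n01) (negbTE nb1').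
have mm1 : is_mate H m1.
  move=> v; have [->|v0] := eqVneq v a0; first by rewrite m1a0 m1b1.
  have [->|vb] := eqVneq v b1; first by rewrite m1b1 m1a0 adj_sym.
  have [->|v1] := eqVneq v a1; first by rewrite !m1a1 eqxx.
  have [mmv amv] := mm v; rewrite m1v // m1v //.
  - by apply: contra v0 => /eqP e; rewrite -mmv e ma0.
  - by apply: contra v1 => /eqP e; rewrite -mmv e mb1.
  - by apply: contra vb => /eqP e; rewrite -mmv e ma1.
have cm1 : #|unmatched m1| <= #|unmatched m|.
  have ina0 : a0 \in unmatched m by rewrite inE ma0.
  have sub : unmatched m1 \subset a1 |: (unmatched m :\ a0).
    apply/subsetP => v; rewrite !inE.
    have [->|v0] := eqVneq v a0; first by rewrite m1a0 (negbTE nb0).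
    have [->|vb] := eqVneq v b1; first by rewrite m1b1 eq_sym (negbTE nb0).
    have [//|v1] := eqVneq v a1; by rewrite m1v.
  rewrite (leq_trans (subset_leq_card sub)) // (leq_trans (leq_card_setU _ _)) //.
  by rewrite cards1 [leqRHS](cardsD1 a0) ina0.
have [pth1 slast] : path (alt_step m1) a1 p /\ side (last a1 p).
  apply: path_sub_side pth => // x x' sx x'p st.
  split; last exact: alt_step_side mm sx st.
  case/existsP: st => b' /and3P[xb' /eqP mb' nb'].
  have sb' : ~~ side b' by have := bip xb'; rewrite sx; case: (side b').
  apply/existsP; exists b'; rewrite m1v ?xb' ?mb' ?eqxx -?mb' //.
  - by apply: contra nb' => /eqP ->; rewrite ma0.
  - by apply: contra na1 => /eqP e; rewrite -mb1 -e mb'.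
  - by apply: contra sb' => /eqP ->.
have sb : ~~ side b by have := bip lb; rewrite slast; case: (side b).
have m1b : m1 b = b.
  rewrite m1v //.
  - by apply: contra sb => /eqP ->.
  - by apply: contra nb1 => /eqP <-; rewrite mb.
  - by apply: contra sb => /eqP ->.
have up1 : uniq (a1 :: p) by rewrite /= na1.
have [m' mm' lt] := IH m1 a1 mm1 sa1 m1a1 pth1 up1 lb m1b.
by exists m' => //; apply: leq_trans lt cm1.
Qed.

(** Augment, starting from the empty matching, as long as some vertex of [Z] has an unmatched
    neighbor. In the end Koenig's set [C] covers all edges and each of its vertices is matched to a
    vertex outside [C]. So [2 * #|C| + #|unmatched m| <= n], while the degrees sum to at most
    [2 * #|C| * t]. *)
Lemma konig t : (forall v, #|nbrs H v| <= t) ->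
  exists2 m, is_mate H m & \sum_v #|nbrs H v| + t * #|unmatched m| <= t * n.
Proof.
move=> le_t; have id_mate : is_mate H id by move=> v; rewrite eqxx.
have [k] := ubnPleq #|unmatched (@id V)|.
elim/ltn_ind: k (@id V) id_mate => k IH m mm le_k.
pose Z := [set a | side a && [exists a0, [&& side a0, m a0 == a0 & connect (alt_step m) a0 a]]].
have [/existsP[a /andP[aZ /existsP[b /andP[ab /eqP mb]]]]|noaug] :=
  boolP [exists a in Z, exists b, adj H a b && (m b == b)].
  move: aZ; rewrite inE => /andP[_ /existsP[a0 /and3P[sa0 /eqP ma0 /connectP[p pth lastp]]]].
  case/shortenP: pth lastp => p' pth' up' _ lastp; rewrite lastp in ab.
  have [m' mm' lt] := augment_path mm sa0 ma0 pth' up' ab mb.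
  exact: (IH _ (leq_trans lt le_k) m' mm' (leqnn _)).
have {}noaug a b : a \in Z -> adj H a b -> m b != b.
  move=> aZ ab; apply: contra noaug => mb; apply/existsP; exists a; rewrite aZ.
  by apply/existsP; exists b; rewrite ab.
exists m => //.
pose C := [set v | if side v then v \notin Z else [exists a in Z, adj H a v]].
have Zside a : a \in Z -> side a by rewrite inE => /andP[].
have cover u v : adj H u v -> (u \in C) || (v \in C).
  wlog su : u v / side u.
    move=> wl uv; have := bip uv; case su: (side u); first by move=> _; apply: wl.
    by case sv: (side v) => // _; rewrite orbC; apply: wl; rewrite // adj_sym.
  move=> uv; rewrite !inE su; have := bip uv; rewrite su; case: (side v) => // _.
  case uZ: (u \in Z); last by move: uZ; rewrite inE su => ->.
  by apply/orP; right; apply/existsP; exists u; rewrite uZ.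
have Cm c : c \in C -> m c != c.
  rewrite inE; case: ifP => sc; last by case/existsP=> a /andP[aZ ac]; apply: noaug ac.
  apply: contra => mc; rewrite inE sc; apply/existsP; exists c.
  by rewrite sc mc connect0.
have mC c : c \in C -> m c \notin C.
  wlog sc : c / side c.
    move=> wl cC; case sc: (side c); first exact: wl.
    have smc : side (m c) by have := bip (mate_adj mm (Cm c cC)); rewrite sc; case: (side _).
    apply/negP => mcC; have := wl (m c) smc mcC; by rewrite (mateK mm) cC.
  move=> cC; have := cC; rewrite inE sc => ncZ; apply/negP.
  have smc : side (m c) = false.
    by have := bip (mate_adj mm (Cm c cC)); rewrite sc; case: (side _).
  rewrite inE smc => /existsP[a /andP[aZ amc]]; case/negP: ncZ.
  move: aZ; rewrite inE => /andP[_ /existsP[a0 /and3P[sa0 ma0 co]]].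
  rewrite inE sc; apply/existsP; exists a0; rewrite sa0 ma0 /=.
  apply: connect_trans co (connect1 _); apply/existsP; exists (m c).
  by rewrite amc (mateK mm) eqxx eq_sym (Cm c cC).
have cC : 2 * #|C| + #|unmatched m| <= n.
  have injm : injective m by apply: inv_inj; apply: mateK mm.
  have d1 : #|C :|: m @: C| = #|C| + #|C|.
    rewrite cardsU card_imset //.
    suff -> : C :&: m @: C = set0 by rewrite cards0 subn0.
    apply/setP => v; rewrite in_setI in_set0; apply/negP => /andP[vC /imsetP[c cC vE]].
    by have := mC c cC; rewrite -vE vC.
  have d2 : #|(C :|: m @: C) :|: unmatched m| = #|C| + #|C| + #|unmatched m|.
    rewrite cardsU d1; suff -> : (C :|: m @: C) :&: unmatched m = set0.
      by rewrite cards0 subn0.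
    apply/setP => v; rewrite in_setI in_set0; apply/negP => /andP[/setUP vC].
    rewrite inE => mv; case: vC => [/Cm|/imsetP[c /Cm + vE]]; first by rewrite mv.
    by move: mv; rewrite vE (mateK mm) eq_sym => ->.
  by have := max_card (mem ((C :|: m @: C) :|: unmatched m)); rewrite d2 card_ord; lia.
have deg : \sum_v #|nbrs H v| <= 2 * \sum_(v in C) #|nbrs H v|.
  have degE v : #|nbrs H v| = \sum_w adj H v w.
    by rewrite -sum1_card big_mkcond; apply: eq_bigr => w _; rewrite inE; case: (adj H v w).
  have -> : \sum_(v in C) #|nbrs H v| = \sum_v \sum_w (v \in C) * adj H v w.
    rewrite big_mkcond; apply: eq_bigr => v _; rewrite -big_distrr /= degE.
    by case: (v \in C); rewrite ?mul1n ?mul0n.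
  rewrite mul2n -addnn {2}exchange_big -big_split /=.
  apply: leq_sum => v _; rewrite degE -big_split /=; apply: leq_sum => w _.
  rewrite [adj H w v]adj_sym; have := @cover v w; case: (adj H v w) => // /(_ isT).
  by case: (v \in C); case: (w \in C).
have degC : \sum_(v in C) #|nbrs H v| <= #|C| * t by rewrite -sum_nat_const leq_sum.
nia.
Qed.

End Konig.

(** * Moments of sampled degrees *)

Section Colorings.
Variables (n Q : nat).
Local Notation V := 'I_n.
Local Notation coloring := {ffun V -> 'I_Q}.

Definition recolor (c : coloring) (u : V) (a : 'I_Q) : coloring :=
  [ffun v => if v == u then a else c v].

(** Redrawing one color preserves the uniform distribution: exchanging the new color with the old
    one is an involution. *)
Lemma sum_recolor u (F : coloring -> nat) :
  \sum_c \sum_a F (recolor c u a) = Q * \sum_c F c.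
Proof.
rewrite pair_bigA /=.
pose swap (x : coloring * 'I_Q) := (recolor x.1 u x.2, x.1 u).
have swapK : involutive swap.
  move=> [c a]; rewrite /swap /=; congr (_, _); last by rewrite ffunE eqxx.
  by apply/ffunP => v; rewrite !ffunE; case: eqP => // ->.
rewrite (reindex_inj (inv_inj swapK)) /=.
rewrite -(pair_bigA _ (fun c a => F (recolor (recolor c u a) u (c u)))) /= big_distrr /=.
apply: eq_bigr => c _; rewrite -[Q in RHS]card_ord -sum_nat_const.
apply: eq_bigr => a _; congr F.
by apply/ffunP => v; rewrite !ffunE; case: eqP => // ->.
Qed.

(** Complementary residues modulo [2 K]: each residue has exactly one partner, and exactly one of
    the two is below [K], which makes the kept graph bipartite. *)
Definition link K (x y : nat) : bool := x %% K.*2 + y %% K.*2 == K.*2.-1.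

Lemma link_sym K x y : link K x y = link K y x.
Proof. by rewrite /link addnC. Qed.

Lemma sum_residue M q r : r < M -> \sum_(0 <= a < q * M) (a %% M == r) = q.
Proof.
move=> lt_r; have M_gt0 : 0 < M by apply: leq_ltn_trans lt_r.
elim: q => [|q IH]; first by rewrite mul0n big_geq.
rewrite (@big_cat_nat _ _ _ (q * M)) ?leq_mul2r ?leqnSn ?orbT //= IH mulSn addnC.
rewrite -{1}[q * M]add0n big_addn addnK.
rewrite (eq_big_nat _ _ (F2 := fun a => nat_of_bool (a == r))); last first.
  by move=> a /andP[_ lt_a]; rewrite addnC modnMDl modn_small.
rewrite big_mkord (bigD1 (Ordinal lt_r)) //= eqxx big1 ?addn0 ?add1n //.
by move=> a; rewrite -val_eqE /= => /negbTE ->.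
Qed.

Lemma sum_link K y : 0 < K -> K.*2 %| Q -> (\sum_(a < Q) link K y a) * K.*2 = Q.
Proof.
move=> K_gt0 /dvdnP[q QE].
have M_gt0 : 0 < K.*2 by rewrite double_gt0.
have lt_y : y %% K.*2 < K.*2 by rewrite ltn_mod.
have lt_r : K.*2.-1 - y %% K.*2 < K.*2 by lia.
rewrite -(big_mkord xpredT (fun a => nat_of_bool (link K y a))).
rewrite (eq_bigr (fun a => nat_of_bool (a %% K.*2 == K.*2.-1 - y %% K.*2))); last first.
  move=> a _; congr nat_of_bool; have lt_a : a %% K.*2 < K.*2 by rewrite ltn_mod.
  by rewrite /link; lia.
by rewrite {1}QE sum_residue.
Qed.

(** As [F] ignores the color of [u], it is independent of the event that [u] is linked to [v], whose
    probability is [1 / 2K] whatever the color of [v]. *)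
Lemma sum_color_link K u v (F : coloring -> nat) : 0 < K -> K.*2 %| Q -> 0 < Q ->
  u != v -> (forall c a, F (recolor c u a) = F c) ->
  (\sum_c F c * link K (c v) (c u)) * K.*2 = \sum_c F c.
Proof.
move=> K_gt0 dvdQ Q_gt0 uv indF; apply/eqP; rewrite -(eqn_pmul2l Q_gt0) mulnA.
pose F' (c : coloring) := F c * link K (c v) (c u).
have -> : Q * (\sum_c F' c) = \sum_c \sum_a F' (recolor c u a) by rewrite sum_recolor.
rewrite big_distrl [X in _ == X]big_distrr /=; apply/eqP; apply: eq_bigr => c _.
rewrite /F' (eq_bigr (fun a : 'I_Q => F c * link K (c v) a)); last first.
  by move=> a _; rewrite indF !ffunE eqxx eq_sym (negbTE uv).
by rewrite -big_distrr /= -mulnA sum_link // mulnC.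
Qed.

Lemma sum_link1 K u v : 0 < K -> K.*2 %| Q -> 0 < Q -> u != v ->
  (\sum_(c : coloring) link K (c v) (c u)) * K.*2 = #|{: coloring}|.
Proof.
move=> K_gt0 dvdQ Q_gt0 uv.
have := @sum_color_link K u v (fun=> 1) K_gt0 dvdQ Q_gt0 uv (fun _ _ => erefl).
by rewrite sum1_card => <-; congr (_ * _); apply: eq_bigr => c _; rewrite mul1n.
Qed.

Lemma sum_link2 K u w v : 0 < K -> K.*2 %| Q -> 0 < Q -> u != v -> w != v -> u != w ->
  (\sum_(c : coloring) link K (c v) (c w) * link K (c v) (c u)) * K.*2 * K.*2 =
  #|{: coloring}|.
Proof.
move=> K_gt0 dvdQ Q_gt0 uv wv uw.
rewrite (@sum_color_link K u v (fun c => link K (c v) (c w))) //; first exact: sum_link1.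
by move=> c a; rewrite !ffunE [v == u]eq_sym (negbTE uv) [w == u]eq_sym (negbTE uw).
Qed.

End Colorings.

Section Moments.
Local Open Scope ring_scope.
Variables (R : realFieldType) (n Q K : nat) (v : 'I_n) (N : {set 'I_n}).
Local Notation coloring := {ffun 'I_n -> 'I_Q}.
Hypotheses (K_gt0 : (0 < K)%N) (dvdQ : (K.*2 %| Q)%N) (Q_gt0 : (0 < Q)%N) (vN : v \notin N).

Definition link_deg (c : coloring) : nat := #|[set u in N | link K (c v) (c u)]|.

Local Notation mu := (#|N|%:R / (K.*2)%:R : R).
Local Notation C := (#|{: coloring}|%:R : R).

Lemma link_degE c : link_deg c = (\sum_(u in N) link K (c v) (c u))%N.
Proof.
rewrite /link_deg -sum1_card big_mkcond [RHS]big_mkcond; apply: eq_bigr => u _.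
by rewrite inE; case: (u \in N) => //=; case: link.
Qed.

Let M_neq0 : (K.*2)%:R != 0 :> R.
Proof. by rewrite pnatr_eq0 double_eq0 -lt0n. Qed.

Let neq_v u : u \in N -> u != v.
Proof. by move=> uN; apply: contraNneq vN => <-. Qed.

Lemma sum_link_deg : \sum_(c : coloring) (link_deg c)%:R = C * mu.
Proof.
rewrite (eq_bigr (fun c : coloring => \sum_(u in N) (link K (c v) (c u))%:R)); last first.
  by move=> c _; rewrite link_degE natr_sum.
rewrite exchange_big /= (eq_bigr (fun _ => C / (K.*2)%:R)); last first.
  move=> u uN; rewrite -natr_sum -(sum_link1 K_gt0 dvdQ Q_gt0 (neq_v uN)) natrM.
  by rewrite mulfK.
by rewrite sumr_const -mulr_natr; field.
Qed.

(** For fixed [v] the events of being linked to [v] are pairwise independent: the diagonal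
    contributes [mu] and the other pairs at most [mu ^+ 2]. *)
Lemma sum_link_deg2 : \sum_(c : coloring) (link_deg c)%:R ^+ 2 <= C * (mu + mu ^+ 2).
Proof.
rewrite (eq_bigr (fun c : coloring =>
   \sum_(w in N) \sum_(u in N) (link K (c v) (c w) * link K (c v) (c u))%:R)); last first.
  move=> c _; rewrite link_degE natr_sum expr2 mulr_suml; apply: eq_bigr => w _.
  by rewrite mulr_sumr; apply: eq_bigr => u _; rewrite natrM.
rewrite exchange_big /=.
apply: (@le_trans _ _ (\sum_(w in N) (C / (K.*2)%:R + #|N|%:R * (C / (K.*2)%:R ^+ 2)))).
  apply: ler_sum => w wN; rewrite exchange_big /= (bigD1 w) //=; apply: lerD.
    rewrite -natr_sum -(sum_link1 K_gt0 dvdQ Q_gt0 (neq_v wN)) natrM mulfK //.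
    by rewrite ler_nat; apply: leq_sum => c _; case: link.
  rewrite mulr_natl -sumr_const [leRHS](bigD1 w) //=.
  rewrite -[leLHS]add0r; apply: lerD; first by rewrite divr_ge0 ?exprn_ge0 ?ler0n.
  apply: ler_sum => u /andP[uN uw]; rewrite -natr_sum.
  rewrite -(sum_link2 K_gt0 dvdQ Q_gt0 (neq_v uN) (neq_v wN) uw) !natrM expr2.
  by rewrite -(mulrA _ (K.*2)%:R (K.*2)%:R) mulfK // mulf_neq0.
rewrite sumr_const -mulr_natl le_eqVlt; apply/orP; left; apply/eqP.
by field.
Qed.

Lemma sum_link_deg_var : \sum_(c : coloring) ((link_deg c)%:R - mu) ^+ 2 <= C * mu.
Proof.
have -> : \sum_(c : coloring) ((link_deg c)%:R - mu) ^+ 2 =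
  \sum_(c : coloring) (link_deg c)%:R ^+ 2 - 2 * mu * (C * mu) + C * mu ^+ 2.
  rewrite (eq_bigr (fun c : coloring =>
    (link_deg c)%:R ^+ 2 + (- (2 * mu)) * (link_deg c)%:R + mu ^+ 2)); last first.
    by move=> c _; ring.
  rewrite !big_split /= -mulr_sumr sum_link_deg sumr_const -(mulr_natr (mu ^+ 2)).
  by rewrite mulNr [C * mu ^+ 2]mulrC.
have := sum_link_deg2; lra.
Qed.

(* A one-sided Chebyshev estimate: above [(1 + 1/k) mu] the identity function
   is dominated by a multiple of the squared deviation. *)
Lemma sum_link_deg_tail (k : nat) : (0 < k)%N -> 0 < mu ->
  \sum_(c : coloring | (1 + 1 / k%:R) * mu < (link_deg c)%:R) (link_deg c)%:R <=
  C * (k * k.+1)%:R.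
Proof.
move=> k_gt0 mu_gt0; have kR : 0 < k%:R :> R by rewrite ltr0n.
apply: (@le_trans _ _ (\sum_(c : coloring)
    ((link_deg c)%:R - mu) ^+ 2 * ((k * k.+1)%:R / mu))); last first.
  have kk_gt0 : 0 < (k * k.+1)%:R / mu :> R.
    by apply: divr_gt0 => //; rewrite ltr0n muln_gt0 k_gt0.
  rewrite -mulr_suml -ler_pdivlMr //.
  apply: (le_trans sum_link_deg_var); rewrite le_eqVlt; apply/orP; left; apply/eqP.
  have kk_neq0 : (k * k.+1)%:R != 0 :> R by rewrite pnatr_eq0 muln_eq0 negb_or -!lt0n k_gt0.
  have gen (x y z : R) : y != 0 -> z != 0 -> x * z = x * y / (y / z).
    by move=> y0 z0; field; rewrite z0 y0.
  by apply: gen => //; rewrite gt_eqF.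
rewrite big_mkcond; apply: ler_sum => c _; case: ifP => [lt_x|_]; last first.
  by rewrite mulr_ge0 ?sqr_ge0 ?divr_ge0 ?ler0n // ltW.
move: (link_deg c)%:R lt_x => x lt_x; move: mu mu_gt0 lt_x => y y_gt0 lt_x.
rewrite mulrA ler_pdivlMr //.
set e := x - y; have xE : x = y + e by rewrite /e; ring.
have e_gt : y <= k%:R * e.
  move: lt_x; rewrite xE mulrDl mul1r ltrD2l mul1r mulrC ltr_pdivrMr // mulrC => /ltW //.
have e_gt0 : 0 < e by nra.
rewrite natrM -natr1 xE.
have h1 : y * y <= (k%:R * e) * (k%:R * e) by apply: ler_pM => //; apply: ltW.
have h2 : y * e <= k%:R * e * e by rewrite ler_wpM2r // ltW.
have := expr2 e; nra.
Qed.

End Moments.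

(** * Sparsification *)

(** Here [E] is [n] times the number of colorings, [S] the total number of unmatched vertices, [y]
    the mean sampled degree and [q] is [k]. The assumption [4 q^3 <= y] makes the tail term at most
    [E (1 + z) y z / 2] for [z = 1 / q]. *)
Lemma sparse_gap (R : realFieldType) (E S y q : R) :
  (1 <= q -> 4 * q ^+ 3 <= y -> 0 <= E ->
  E * y <= (1 + 1 / q) * y * (E - S) + 2 * (E * (q * (q + 1))) -> S <= E * (2 / q))%R.
Proof.
move=> q1 y_ge E_ge0 main; have q0 : (0 < q)%R by lra.
have q3 : (0 < q ^+ 3)%R by rewrite exprn_gt0.
have y0 : (0 < y)%R by lra.
pose z := (1 / q)%R; have z0 : (0 < z)%R by rewrite divr_gt0.
have -> : (2 / q = 2 * z)%R by rewrite /z mul1r.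
have W : (2 * (q * (q + 1)) <= (1 + z) * y * z / 2)%R.
  have -> : ((1 + z) * y * z / 2 = (q + 1) * y / (2 * q ^+ 2))%R.
    by rewrite /z; field; rewrite gt_eqF.
  rewrite ler_pdivlMr ?mulr_gt0 ?exprn_gt0 //.
  have -> : (2 * (q * (q + 1)) * (2 * q ^+ 2) = (q + 1) * (4 * q ^+ 3))%R by ring.
  by apply: ler_wpM2l => //; lra.
move: main; rewrite -/z; clearbody z => main; have EW := ler_wpM2l E_ge0 W.
have z1 : (0 < 1 + z)%R by lra.
have zy0 : (0 < (1 + z) * y)%R by rewrite mulr_gt0.
rewrite -(ler_pM2l zy0).
have y0' := ltW y0; have z0' := ltW z0.
have h1 : (0 <= E * (y * z * z))%R by rewrite !mulr_ge0.
have h2 : (0 <= E * (y * z))%R by rewrite !mulr_ge0.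
lra.
Qed.

Section Sparsifier.
Variables (n k : nat).
Hypothesis k_gt0 : 0 < k.
Local Notation V := 'I_n.
(** The seed is drawn before the degree is known. Every modulus [2 K] that occurs is at most [n] and
    so divides [n!], which makes the residues of the colors exactly uniform. *)
Local Notation coloring := {ffun V -> 'I_(n`!)}.
Implicit Types (c : coloring) (G : sgraph n) (u v w : V).

(* A vertex of degree [d] keeps the neighbors whose color is complementary to
   its own among [2 * color_rate d] colors, about [4 k^3] of them; small degrees
   are left alone. *)
Definition color_rate (d : nat) : nat := d %/ (8 * k ^ 3).

(** In the sampled case, the floor of [1 + 1 / k] times the mean sampled degree [d / 2K]. *)
Definition degree_cap (d : nat) : nat :=
  if color_rate d == 0 then d else (d * k.+1) %/ ((color_rate d).*2 * k).

Definition linked c (d : nat) u v : bool :=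
  (color_rate d == 0) || link (color_rate d) (c u) (c v).

Definition samples c v (N : {set V}) : {set V} := [set w in N | linked c #|N| v w].

Definition light c v (N : {set V}) : bool := #|samples c v N| <= degree_cap #|N|.

(** The kept graph must be defined for every input; comparing the degrees of the endpoints makes the
    relation symmetric also when the input is not regular. *)
Definition sparse_adj c G : rel V := fun u v =>
  [&& adj G u v, #|nbrs G u| == #|nbrs G v|, linked c #|nbrs G u| u v,
      light c u (nbrs G u) & light c v (nbrs G v)].

Lemma linked_sym c d u v : linked c d u v = linked c d v u.
Proof. by rewrite /linked link_sym. Qed.

Lemma sparse_sym c G : symmetric (sparse_adj c G).
Proof.
move=> u v; rewrite /sparse_adj adj_sym [#|nbrs G u| == _]eq_sym.
case: (adj G v u) => //=; case: eqP => //= ->.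
by rewrite linked_sym; congr (_ && _); rewrite andbC.
Qed.

Lemma sparse_irr c G : irreflexive (sparse_adj c G).
Proof. by move=> u; rewrite /sparse_adj adj_irr. Qed.

Definition sparse c G : sgraph n := SGraph (@sparse_sym c G) (@sparse_irr c G).

(** Since [1 + 1 / k <= 2], the cap is at most [d / K] when [K > 0], and
    [d < (K + 1) * 8 k^3 <= K * 16 k^3]. *)
Lemma degree_cap_leq d : degree_cap d <= 16 * k ^ 3.
Proof.
have D_gt0 : 0 < 8 * k ^ 3 by rewrite muln_gt0 expn_gt0 k_gt0.
have lt_d : d < (color_rate d).+1 * (8 * k ^ 3) by apply: ltn_ceil.
rewrite /degree_cap; case: eqP => [K0|/eqP]; first by rewrite K0 in lt_d; lia.
rewrite -lt0n => K_gt0; apply: (@leq_trans (d %/ color_rate d)).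
  apply: (@leq_trans ((d * (2 * k)) %/ ((color_rate d).*2 * k))).
    by apply: leq_div2r; rewrite leq_mul2l; apply/orP; right; lia.
  rewrite -[X in _ %/ X](_ : color_rate d * (2 * k) = _); last by rewrite -muln2 mulnA.
  by rewrite divnMr // muln_gt0 k_gt0.
apply: ltnW; rewrite ltn_divLR //; apply: leq_trans lt_d _.
have -> : 16 * k ^ 3 = 2 * (8 * k ^ 3) by lia.
by move: (color_rate d) K_gt0 (8 * k ^ 3) => K K_gt0 E; nia.
Qed.

Lemma card_nbrs_sparse c G v : #|nbrs (sparse c G) v| <= 16 * k ^ 3.
Proof.
case: (boolP (light c v (nbrs G v))) => [li|nli]; last first.
  rewrite (_ : nbrs _ v = set0) ?cards0 //; apply/setP => w; rewrite !inE /=.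
  by rewrite /sparse_adj (negbTE nli) !andbF.
apply: leq_trans (degree_cap_leq #|nbrs G v|); apply: leq_trans li.
apply: subset_leq_card; apply/subsetP => w; rewrite !inE => /and5P[vw _ lk _ _].
by rewrite vw.
Qed.

(** One probe finds the samples of [v]. An overloaded vertex is isolated; otherwise only the
    samples, at most [16 k^3], are probed to test their own load. *)
Lemma local_sparse c v :
  local (fun _ => (16 * k ^ 3).+1) (fun G => nbrs (sparse c G) v).
Proof.
pose S (N : {set V}) := if light c v N then samples c v N else set0.
pose final (N : {set V}) (f : {ffun V -> {set V}}) :=
  [set w in S N | (#|N| == #|f w|) && light c w (f w)].
have lK (N : {set V}) := local_map (final N) (local_mask (fun=> set0) (S N) (@local_nbrs n)).
apply: local_sub (local_bind (local_nbrs v) lK) => G.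
  rewrite muln1 add1n ltnS /S; case: ifP => [li|_]; last by rewrite cards0.
  exact: leq_trans li (degree_cap_leq _).
apply/setP => w; rewrite !inE ffunE -[adj _ v w]/(sparse_adj c G v w) /sparse_adj /S.
case: (boolP (light c v (nbrs G v))) => li; last by rewrite inE /= !andbF.
rewrite !inE; case: (boolP (adj G v w)) => //= vw; case: (linked _ _ v w) => /=.
  by [].
by rewrite andbF.
Qed.

Section Quality.
Variables (R : realFieldType) (d : nat) (G : sgraph n).
Hypothesis regG : regular G d.
Local Notation K := (color_rate d).
Local Notation X c v := #|samples c v (nbrs G v)|.

Lemma sparse_id c u v : K = 0 -> adj (sparse c G) u v = adj G u v.
Proof.
move=> K0; have le_d w : X c w <= d.
  rewrite -[leqRHS](regG w); apply: subset_leq_card.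
  by apply/subsetP => x; rewrite inE => /andP[].
by rewrite /= /sparse_adj /light /linked /degree_cap !regG K0 /= eqxx !le_d !andbT.
Qed.

(** A sampled edge that is not kept has an overloaded endpoint, and it counts once from each of its
    ends. *)
Lemma sum_samples_leq c :
  \sum_v X c v <= \sum_v #|nbrs (sparse c G) v| +
    2 * \sum_(v | degree_cap d < X c v) X c v.
Proof.
pose a v w : nat := adj G v w && linked c d v w.
have aC v w : a v w = a w v by rewrite /a adj_sym linked_sym.
have XE v : X c v = \sum_w a v w.
  rewrite -sum1_card big_mkcond; apply: eq_bigr => w _; rewrite !inE regG /a.
  by case: (_ && _).
have dE v : #|nbrs (sparse c G) v| =
    \sum_w (if (X c v <= degree_cap d) && (X c w <= degree_cap d) then a v w else 0).
  rewrite -sum1_card big_mkcond; apply: eq_bigr => w _.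
  rewrite inE /= /sparse_adj /light !regG eqxx /a /=.
  by case: (adj G v w); case: (linked _ _ _ _); case: (_ <= _); case: (_ <= _).
have tE : \sum_(v | degree_cap d < X c v) X c v =
    \sum_v \sum_w (if degree_cap d < X c v then a v w else 0).
  rewrite big_mkcond; apply: eq_bigr => v _; case: ifP => _; first by rewrite XE.
  by rewrite big1.
rewrite mul2n -addnn tE {2}exchange_big -!big_split /=.
apply: leq_sum => v _; rewrite dE XE -!big_split /=; apply: leq_sum => w _.
rewrite [a w v]aC -XE; case: leqP; case: leqP => /=; rewrite ?addn0 ?add0n ?leq_addr //.
Qed.

Hypotheses (n_gt0 : 0 < n) (K_gt0 : 0 < K).

Lemma degree_leq : d <= n.
Proof. by rewrite -(regG (Ordinal n_gt0)) -[leqRHS](card_ord n) max_card. Qed.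

Lemma rate_leq : K * (8 * k ^ 3) <= d.
Proof. exact: leq_trunc_div. Qed.

Lemma rate_dvd : K.*2 %| n`!.
Proof.
rewrite dvdn_fact // double_gt0 K_gt0 /=; apply: leq_trans degree_leq.
apply: leq_trans rate_leq; rewrite -muln2 leq_mul2l; apply/orP; right.
have : 0 < k ^ 3 by rewrite expn_gt0 k_gt0.
lia.
Qed.

Lemma sparse_bip c u v : adj (sparse c G) u v -> (c u %% K.*2 < K) != (c v %% K.*2 < K).
Proof.
rewrite /= /sparse_adj regG /linked (gtn_eqF K_gt0) /= => /and5P[_ _ /eqP + _ _].
by lia.
Qed.

Local Notation mu := (d%:R / (K.*2)%:R : R)%R.

Lemma samples_link_deg c v : X c v = link_deg K v (nbrs G v) c.
Proof.
by congr #|pred_of_set _|; apply/setP => w; rewrite !inE /linked regG (gtn_eqF K_gt0).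
Qed.

Lemma mu_ge : (4 * k%:R ^+ 3 <= mu)%R.
Proof.
rewrite ler_pdivlMr ?ltr0n ?double_gt0 // -natrX -!natrM ler_nat.
by apply: leq_trans rate_leq; rewrite -muln2; lia.
Qed.

Lemma degree_cap_real : ((degree_cap d)%:R <= (1 + 1 / k%:R) * mu)%R /\
  (forall x : nat, (degree_cap d < x)%N -> ((1 + 1 / k%:R) * mu < x%:R)%R).
Proof.
have kR : (0 < k%:R :> R)%R by rewrite ltr0n.
have KR : (0 < (K.*2)%:R :> R)%R by rewrite ltr0n double_gt0.
have M_gt0 : 0 < K.*2 * k by rewrite muln_gt0 double_gt0 K_gt0.
have -> : ((1 + 1 / k%:R) * mu = (d * k.+1)%:R / (K.*2 * k)%:R :> R)%R.
  rewrite !natrM -natr1; move: (K.*2)%:R%R KR => y y0; field.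
  by rewrite !gt_eqF.
rewrite /degree_cap (gtn_eqF K_gt0); split=> [|x].
  by rewrite ler_pdivlMr ?ltr0n // -natrM ler_nat leq_trunc_div.
by rewrite ltn_divLR // ltr_pdivrMr ?ltr0n // -natrM ltr_nat.
Qed.

(** For each coloring, [konig] with the cap as degree bound limits the kept degrees by the cap times
    the number of matched vertices. On average the sampled degrees sum to [n mu], and by the tail
    estimate the cut-off vertices cost little of this; [sparse_gap] compares the two. *)
Lemma sparse_mates_dense : exists nn : coloring -> V -> V,
  (forall c, is_mate (sparse c G) (nn c)) /\
  (\sum_c (#|unmatched (nn c)|%:R : R) <= #|{: coloring}|%:R * (n%:R * (2 / k%:R)))%R.
Proof.
pose t := degree_cap d.
have /fin_all_exists2[nn mnn kon] (c : coloring) : exists2 m : V -> V, is_mate (sparse c G) m &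
    \sum_v #|nbrs (sparse c G) v| + t * #|unmatched m| <= t * n.
  apply: (konig (side := fun v => c v %% K.*2 < K)); first exact: sparse_bip.
  move=> v; case: (boolP (light c v (nbrs G v))) => [li|nli]; last first.
    rewrite (_ : nbrs _ v = set0) ?cards0 //; apply/setP => w; rewrite !inE /=.
    by rewrite /sparse_adj (negbTE nli) !andbF.
  move: (li); rewrite /light regG; apply: leq_trans.
  apply: subset_leq_card; apply/subsetP => w; rewrite !inE => /and5P[vw _ lk _ _].
  by rewrite vw.
exists nn; split=> //.
have [cap_le cap_lt] := degree_cap_real.
have kR : (1 <= k%:R :> R)%R by rewrite ler1n.
have mu_le := mu_ge.
have mu_gt0 : (0 < mu)%R.
  by apply: lt_le_trans mu_le; rewrite mulr_gt0 ?exprn_gt0 ?ltr0n.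
pose C : R := #|{: coloring}|%:R%R.
pose S : R := (\sum_c #|unmatched (nn c)|%:R)%R.
have each c : (\sum_v ((X c v)%:R : R) <= (1 + 1 / k%:R) * mu * (n%:R - #|unmatched (nn c)|%:R) +
    2 * \sum_(v | (degree_cap d < X c v)%N) (X c v)%:R)%R.
  have := sum_samples_leq c; rewrite -(ler_nat R) natrD natrM !natr_sum => le1.
  have := kon c; rewrite -(ler_nat R) natrD natr_sum !natrM => le2.
  have un : (#|unmatched (nn c)|%:R <= n%:R :> R)%R.
    by rewrite ler_nat -[leqRHS](card_ord n) max_card.
  have := ler_wpM2r (x := n%:R - #|unmatched (nn c)|%:R) _ cap_le.
  rewrite subr_ge0 un -/t => /(_ isT) le3.
  move: le1 le2 le3; set A := (\sum_v _)%R; set B := (\sum_v _)%R; set T := (\sum_(v | _) _)%R.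
  lra.
have N_v v : v \notin nbrs G v by rewrite inE adj_irr.
have mean : (\sum_(c : coloring) \sum_v ((X c v)%:R : R) = n%:R * (C * mu))%R.
  rewrite exchange_big /= (eq_bigr (fun _ => C * mu)%R).
    by rewrite sumr_const card_ord [RHS]mulr_natl.
  move=> v _; rewrite (eq_bigr (fun c => (link_deg K v (nbrs G v) c)%:R)%R); last first.
    by move=> c _; rewrite samples_link_deg.
  by rewrite sum_link_deg ?rate_dvd ?fact_gt0 // regG.
have tail : (\sum_(c : coloring) \sum_(v | (degree_cap d < X c v)%N) ((X c v)%:R : R) <=
    n%:R * (C * (k * k.+1)%:R))%R.
  rewrite (eq_bigr (fun c : coloring => \sum_v
     (if (degree_cap d < X c v)%N then (X c v)%:R else 0))%R); last first.
    by move=> c _; rewrite big_mkcond.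
  rewrite exchange_big /= [leRHS]mulr_natl -[Y in (_ <= _ *+ Y)%R](card_ord n) -sumr_const.
  apply: ler_sum => v _.
  have := @sum_link_deg_tail R _ _ _ v (nbrs G v) K_gt0 rate_dvd (fact_gt0 n) (N_v v) k k_gt0.
  rewrite regG => /(_ mu_gt0); apply: le_trans; rewrite [leRHS]big_mkcond /=.
  apply: ler_sum => c _; rewrite samples_link_deg; case: ifP => [/cap_lt ->//|_].
  by case: ifP => // _; rewrite ler0n.
have : (n%:R * (C * mu) <= (1 + 1 / k%:R) * mu * (n%:R * C - S) +
    2 * (n%:R * (C * (k * k.+1)%:R)))%R.
  rewrite -mean; apply: (le_trans (ler_sum _ (fun c _ => each c))).
  rewrite big_split /= -!mulr_sumr sumrB sumr_const -[(n%:R *+ _)%R]mulr_natr -/C -/S.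
  by rewrite lerD2l ler_pM2l.
move=> main; have -> : (C * (n%:R * (2 / k%:R)) = n%:R * C * (2 / k%:R))%R by ring.
apply: (sparse_gap kR mu_le); first by rewrite mulr_ge0 ?ler0n.
by rewrite -[((_ * C) * _)%R]mulrA -[((_ * C) * (_ * _))%R]mulrA natr1 -natrM.
Qed.

End Quality.

Lemma sparse_mates (R : realFieldType) d (G : sgraph n) (nn0 : V -> V) :
  regular G d -> is_mate G nn0 ->
  exists nn : coloring -> V -> V, (forall c, is_mate (sparse c G) (nn c)) /\
  (\sum_c (#|unmatched (nn c)|%:R : R) <=
     #|{: coloring}|%:R * (#|unmatched nn0|%:R + n%:R * (2 / k%:R)))%R.
Proof.
move=> regG mnn0; have err_ge0 : (0 <= n%:R * (2 / k%:R) :> R)%R.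
  by rewrite mulr_ge0 ?divr_ge0 ?ler0n.
have [K0|K_gt0] := posnP (color_rate d).
  exists (fun=> nn0); split=> [c v|].
    by have [mmv amv] := mnn0 v; split=> // /amv; rewrite (sparse_id regG).
  by rewrite sumr_const -[leLHS]mulr_natl ler_wpM2l ?ler0n // lerDl.
have [n0|n_gt0] := posnP n.
  exists (fun _ => id); split=> [c v|]; first by rewrite eqxx.
  rewrite big1 => [|c _]; first by rewrite mulr_ge0 ?addr_ge0 ?ler0n.
  apply/eqP; rewrite pnatr_eq0 cards_eq0; apply/eqP/setP => v.
  by have := ltn_ord v; rewrite {2}n0.
have [nn [mnn le]] := sparse_mates_dense R regG n_gt0 K_gt0.
exists nn; split=> //; apply: (le_trans le); apply: ler_wpM2l; first by rewrite ler0n.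
by rewrite lerDr ler0n.
Qed.
End Sparsifier.

(** * Matchings as sets of edges *)

Section MatchingSets.
Variables (n : nat) (G : sgraph n).
Local Notation V := 'I_n.

Lemma edgesP (e : {set V}) :
  reflect (exists u v, adj G u v /\ e = [set u; v]) (e \in edges G).
Proof.
apply: (iffP imsetP) => [[[u v]]|[u [v [uv ->]]]].
  by rewrite inE => uv ->; exists u, v.
by exists (u, v); rewrite ?inE.
Qed.

Lemma card_edge (e : {set V}) : e \in edges G -> #|e| = 2.
Proof.
case/edgesP => u [v [uv ->]]; rewrite cards2.
by case: eqVneq uv => // ->; rewrite adj_irr.
Qed.

Lemma card_cover_matching (M : {set {set V}}) : matching G M -> #|cover M| = 2 * #|M|.
Proof.
case/andP => /subsetP ME /eqP <-; rewrite mulnC -sum_nat_const.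
by apply: eq_bigr => e eM; rewrite card_edge ?ME.
Qed.

Lemma mate_of_matching (M : {set {set V}}) : matching G M ->
  exists2 nn, is_mate G nn & #|unmatched nn| + 2 * #|M| = n.
Proof.
move=> MM; case/andP: (MM) => /subsetP ME triv.
pose nn v := odflt v [pick w | [set v; w] \in M].
have nnP v : (nn v != v -> [set v; nn v] \in M) /\ (nn v == v -> forall w, [set v; w] \notin M).
  rewrite /nn; case: pickP => [w wM|no] /=; last by rewrite eqxx; split=> // _ w; rewrite no.
  by split=> // /eqP wv; have := card_edge (ME _ wM); rewrite wv cards2 eqxx.
have same e e' x : e \in M -> e' \in M -> x \in e -> x \in e' -> e = e'.
  move=> eM e'M xe xe'; apply/eqP/negPn/negP => neq.
  have /pred0P/(_ x) := (trivIsetP triv) e e' eM e'M neq.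
  by rewrite /= xe xe'.
have edge_adj u v : [set u; v] \in M -> adj G u v.
  move=> uvM; case/edgesP: (ME _ uvM) => a [b [ab /setP eqe]].
  have := card_edge (ME _ uvM); rewrite cards2; case: (eqVneq u v) => // nuv _.
  have := eqe u; have := eqe v; rewrite !inE !eqxx orbT /= => /esym/orP hv /esym/orP hu.
  case: hu => /eqP hu; case: hv => /eqP hv; first by rewrite hu hv eqxx in nuv.
  - by rewrite hu hv.
  - by rewrite hu hv adj_sym.
  - by rewrite hu hv eqxx in nuv.
exists nn.
  move=> v; case: (boolP (nn v == v)) => [/eqP e|nv]; first by rewrite !e.
  have [/(_ nv) vM _] := nnP v; split; last by move=> _; apply: edge_adj.
  have nw : nn (nn v) != nn v.
    by apply/negP => /(proj2 (nnP (nn v)))/(_ v); rewrite setUC vM.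
  have [/(_ nw) wM _] := nnP (nn v).
  have /setP eqe := same _ _ (nn v) wM vM (set21 _ _) (set22 _ _).
  by have := eqe (nn (nn v)); rewrite !inE eqxx orbT (negbTE nw) orbF => /esym/eqP.
rewrite -card_cover_matching //.
have -> : cover M = ~: unmatched nn.
  apply/setP => v; rewrite !inE; apply/bigcupP/idP => [[e eM ve]|nv].
    case/edgesP: (ME _ eM) => a [b [ab eE]]; apply/negP => /(proj2 (nnP v)) no.
    move: ve; rewrite eE !inE => /orP[] /eqP vE; rewrite eE in eM.
      by have := no b; rewrite vE eM.
    by have := no a; rewrite vE setUC eM.
  by exists [set v; nn v]; rewrite ?set21 //; apply: (proj1 (nnP v)).
by rewrite cardsC card_ord.
Qed.

Definition mate_edges (m : V -> V) : {set {set V}} := [set [set v; m v] | v in ~: unmatched m].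

Lemma mem_mate_edges m e x : is_mate G m -> e \in mate_edges m -> x \in e ->
  m x != x /\ e = [set x; m x].
Proof.
move=> mm /imsetP[v]; rewrite !inE => nv ->; rewrite !inE => /orP[] /eqP -> //.
by rewrite (mateK mm) eq_sym setUC.
Qed.

Lemma matching_mate_edges m : is_mate G m -> matching G (mate_edges m).
Proof.
move=> mm; apply/andP; split.
  apply/subsetP => e /imsetP[v]; rewrite !inE => nv ->.
  by apply/edgesP; exists v, (m v); split=> //; apply: mate_adj mm nv.
apply/trivIsetP => e e' eM e'M neq; rewrite -setI_eq0; apply/eqP/setP => x.
rewrite in_setI in_set0; apply/negP => /andP[xe xe']; case/eqP: neq.
have [_ ->] := mem_mate_edges mm eM xe.
by have [_ ->] := mem_mate_edges mm e'M xe'.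
Qed.

Lemma card_mate_edges m : is_mate G m -> #|unmatched m| + 2 * #|mate_edges m| = n.
Proof.
move=> mm; rewrite -card_cover_matching; last exact: matching_mate_edges.
have -> : cover (mate_edges m) = ~: unmatched m.
  apply/setP => v; apply/bigcupP/idP => [[e eM ve]|nv].
    by have [nv _] := mem_mate_edges mm eM ve; rewrite !inE.
  by exists [set v; m v]; rewrite ?set21 //; apply: imset_f.
by rewrite cardsC card_ord.
Qed.

Lemma matching0 : matching G set0.
Proof. by rewrite /matching sub0set /=; apply/trivIsetP => A B; rewrite inE. Qed.

Lemma max_matching_mate : exists2 nn, is_mate G nn &
  #|unmatched nn| + 2 * max_matching_size G = n.
Proof.
have pos : 0 < #|[pred M | matching G M]|.
  by apply/card_gt0P; exists set0; apply: matching0.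
have [M MM] := eq_bigmax_cond (fun M : {set {set V}} => #|M|) pos.
rewrite /max_matching_size => ->; exact: mate_of_matching.
Qed.

Lemma mate_leq_max m : is_mate G m -> n <= #|unmatched m| + 2 * max_matching_size G.
Proof.
move=> mm; rewrite -{1}(card_mate_edges mm) leq_add2l leq_mul2l /=.
rewrite /max_matching_size; apply: leq_bigmax_cond; exact: matching_mate_edges.
Qed.

(** The unmatched vertices of a maximum matching are independent, so all their edges end in matched
    vertices, each of which receives at most [d]. This converts errors proportional to [n] into
    relative ones. *)
Lemma regular_max_matching d : regular G d -> 0 < d -> n <= 4 * max_matching_size G.
Proof.
move=> regG d_gt0; have [nn mnn eqn] := max_matching_mate.
suff : #|unmatched nn| <= 2 * max_matching_size G by lia.
have cm : #|~: unmatched nn| = 2 * max_matching_size G.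
  by have := cardsC (unmatched nn); rewrite card_ord; lia.
rewrite -cm -(leq_pmul2r d_gt0) -!sum_nat_const.
rewrite (eq_bigr (fun v => \sum_(w in ~: unmatched nn) adj G v w)); last first.
  move=> v vU; rewrite -(regG v) -sum1_card big_mkcond [RHS]big_mkcond.
  apply: eq_bigr => w _; rewrite !inE; case: (boolP (adj G v w)) => // vw; last by rewrite if_same.
  case: (boolP (nn w == w)) => //= /eqP fw.
  have fv : nn v = v by move: vU; rewrite inE => /eqP.
  have [m' mm' lt] := augment_edge mnn vw fv fw.
  by have := mate_leq_max mm'; lia.
rewrite exchange_big /=; apply: leq_sum => w _.
rewrite -(regG w) -sum1_card big_mkcond [leqRHS]big_mkcond; apply: leq_sum => v _.
by rewrite [v \in nbrs _ _]inE adj_sym; case: ifP => // _; case: (adj G w v).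
Qed.

End MatchingSets.

(** * The algorithm *)

(** The base is one more than the degree bound of the sparsifier. The exponent is 28 times a bound
    on the sum of the round lengths, plus one for the cost of a query to the sparsifier. *)
Definition probe_bound (k : nat) : nat := (16 * k ^ 3).+1 ^ (28 * (128 * k) ^ 2).+1.

Lemma sum_phase_len j : \sum_(i < j) phase_len i <= j ^ 2.
Proof.
apply: (@leq_trans (\sum_(i < j) j)); last by rewrite sum_nat_const card_ord mulnn.
apply: leq_sum => i _; by have := ltn_ord i; rewrite /phase_len; lia.
Qed.

Definition idle_lca : lca :=
  @LCA (fun=> unit) (fun=> eq_leq (esym card_unit)) (fun n _ _ => Answer n false).

Lemma matching_idle n (G : sgraph n) (s : lca_seed idle_lca n) :
  matching G (lca_output G s).
Proof.
have -> : lca_output G s = set0 by apply/setP => e; rewrite !inE andbF.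
exact: matching0.
Qed.

Section Algorithm.
Variables (R : realFieldType) (k : nat).
Hypothesis k_gt0 : 0 < k.
Local Notation rounds := (128 * k).

Let D_gt0 : 0 < 16 * k ^ 3.
Proof. by rewrite muln_gt0 expn_gt0 k_gt0. Qed.

Definition matcher_of n (c : {ffun 'I_n -> 'I_(n`!)}) :=
  matcher_exists R D_gt0 (card_nbrs_sparse k_gt0 c) (local_sparse k_gt0 c) rounds.

Definition alg_seed (n : nat) : finType :=
  ({ffun 'I_n -> 'I_(n`!)} * phase_seed n rounds)%type.

Lemma alg_seed_gt0 n : 0 < #|alg_seed n|.
Proof.
rewrite card_prod muln_gt0 card_phase_seed_gt0 andbT card_ffun !card_ord.
by rewrite expn_gt0 fact_gt0.
Qed.

Definition alg_mate n (s : alg_seed n) : sgraph n -> 'I_n -> 'I_n :=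
  projT1 (matcher_of s.1) s.2.

Definition alg_tree n (s : alg_seed n) (v : 'I_n) : dtree n ({set 'I_n} * 'I_n) :=
  sval ((projT2 (matcher_of s.1)).1.1 s.2 v).

Definition alg_query n (s : alg_seed n) (e : {set 'I_n}) : strategy n :=
  if [pick u in e] is Some u then
    strategy_of (tbind (alg_tree s u)
      (fun x => Leaf n ((x.2 != u) && (e == [set u; x.2]))))
  else Answer n false.

Definition algorithm : lca := LCA alg_seed_gt0 alg_query.

Lemma alg_treeP n (s : alg_seed n) v G :
  (teval G (alg_tree s v)).2 = alg_mate s G v /\
  tcost G (alg_tree s v) <= probe_bound k.
Proof.
rewrite /alg_tree; case: (_.1.1 _ _) => t tP /=; have [-> le_t] := tP G.
split; first by rewrite ffunE.
apply: leq_trans le_t _; rewrite /iter_cost /probe_bound [leqRHS]expnSr leq_mul2r.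
by rewrite leq_pexp2l // leq_mul2l sum_phase_len !orbT.
Qed.

Lemma is_mate_alg_sparse n (s : alg_seed n) G : is_mate (sparse k s.1 G) (alg_mate s G).
Proof. exact: (projT2 (matcher_of s.1)).1.2. Qed.

Lemma is_mate_alg n (s : alg_seed n) G : is_mate G (alg_mate s G).
Proof.
move=> v; have [mm am] := is_mate_alg_sparse s G v; split=> // /am.
by case/and5P.
Qed.

Lemma alg_output n (s : alg_seed n) G :
  lca_output (A := algorithm) G s = mate_edges (alg_mate s G).
Proof.
have mm := is_mate_alg s G; apply/setP => e; rewrite inE.
apply/andP/idP => [[eE]|eM].
  rewrite /= /alg_query; case: pickP => [u ue|//].
  rewrite answer_strategy_of teval_bind /=; have [-> _] := alg_treeP s u G.
  by case/andP => nu /eqP ->; apply: imset_f; rewrite !inE.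
have /andP[/subsetP sub _] := matching_mate_edges mm.
have eE := sub e eM; split=> //.
rewrite /= /alg_query; case: pickP => [u ue|no]; last first.
  by have := card_edge eE; rewrite (eq_card0 no).
rewrite answer_strategy_of teval_bind /=; have [-> _] := alg_treeP s u G.
by have [-> eqe] := mem_mate_edges mm eM ue; rewrite {1}eqe eqxx.
Qed.

Lemma alg_probes n (s : alg_seed n) e G : probes G (alg_query s e) <= probe_bound k.
Proof.
rewrite /alg_query; case: pickP => [u ue|//].
rewrite probes_strategy_of tcost_bind addn0.
by have [_] := alg_treeP s u G.
Qed.

Local Open Scope ring_scope.

(** Of the error [3 / k], sparsification causes [2 / k]; the gap after [128 k] rounds is at most
    [1 / k]. *)
Lemma alg_unmatched n d (G : sgraph n) : regular G d ->
  \sum_(s : alg_seed n) (#|unmatched (alg_mate s G)|%:R : R) <=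
  #|alg_seed n|%:R * (n%:R - 2 * (max_matching_size G)%:R + n%:R * (3 / k%:R)).
Proof.
move=> regG; have [nn0 mnn0 nE] := max_matching_mate G.
have [nn [mnn avg_nn]] := sparse_mates k_gt0 R regG mnn0.
have kR : 0 < k%:R :> R by rewrite ltr0n.
pose W : R := #|phase_seed n rounds|%:R.
have -> : \sum_(s : alg_seed n) (#|unmatched (alg_mate s G)|%:R : R) =
  \sum_(c : {ffun 'I_n -> 'I_(n`!)}) \sum_(w : phase_seed n rounds)
     #|unmatched (alg_mate (c, w) G)|%:R.
  by rewrite pair_bigA /=; apply: eq_bigr => -[].
apply: (@le_trans _ _ (\sum_c W * (#|unmatched (nn c)|%:R + n%:R * (128 / (rounds + 8)%:R)))).
  by apply: ler_sum => c _; apply: (projT2 (matcher_of c)).2.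
rewrite -mulr_sumr card_prod natrM -/W [leRHS]mulrAC [leRHS]mulrC.
apply: ler_wpM2l; first by rewrite ler0n.
rewrite big_split /= sumr_const -[(_ *+ _)]mulr_natl.
set C : R := #|_|%:R in avg_nn *.
have -> : n%:R - 2 * (max_matching_size G)%:R = #|unmatched nn0|%:R :> R.
  by rewrite -{1}nE natrD natrM addrK.
have small : 128 / (rounds + 8)%:R <= 1 / k%:R :> R.
  rewrite ler_pdivrMr ?ltr0n ?addn_gt0 ?orbT // mul1r ler_pdivlMl // mulrC -natrM ler_nat.
  by rewrite leq_addr.
apply: (@le_trans _ _ (C * (#|unmatched nn0|%:R + n%:R * (2 / k%:R)) + C * (n%:R * (1 / k%:R)))).
  by apply: lerD => //; apply: ler_wpM2l; rewrite ?ler0n //; apply: ler_wpM2l; rewrite ?ler0n.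
rewrite le_eqVlt; apply/orP; left; apply/eqP.
by field; rewrite gt_eqF.
Qed.

(** The error [3 n / k] in unmatched vertices is at most 12 / k times the maximum matching size by
    [regular_max_matching], and an edge matches two vertices, hence 6. *)
Lemma alg_expected n d (G : sgraph n) : regular G d ->
  (1 - 6 / k%:R) * (max_matching_size G)%:R <= expected_size R algorithm G.
Proof.
move=> regG; have kR : 0 < k%:R :> R by rewrite ltr0n.
have S_gt0 : 0 < #|alg_seed n|%:R :> R by rewrite ltr0n alg_seed_gt0.
rewrite /expected_size ler_pdivlMr //.
have [d0|d_gt0] := posnP d.
  have -> : max_matching_size G = 0%N.
    apply/eqP; rewrite -leqn0; apply/bigmax_leqP => M /andP[/subsetP ME _].
    rewrite leqn0 cards_eq0 -subset0; apply/subsetP => e /ME/edgesP[u [v [uv _]]].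
    by have := regG u; rewrite d0 => /eqP; rewrite cards_eq0 => /eqP/setP/(_ v); rewrite !inE uv.
  by rewrite mulr0 mul0r sumr_ge0.
have n_le : n%:R <= 4 * (max_matching_size G)%:R :> R.
  by rewrite -natrM ler_nat (regular_max_matching regG).
have unm := alg_unmatched regG.
pose S : R := #|alg_seed n|%:R; rewrite -/S in S_gt0 unm *.
have outE (s : alg_seed n) : 2 * #|lca_output (A := algorithm) G s|%:R =
    n%:R - #|unmatched (alg_mate s G)|%:R :> R.
  have /(congr1 (fun x => x%:R : R)) := card_mate_edges (is_mate_alg s G).
  by rewrite alg_output natrD natrM; lra.
have sumE : 2 * \sum_(s : alg_seed n) (#|lca_output (A := algorithm) G s|%:R : R) =
    S * n%:R - \sum_(s : alg_seed n) #|unmatched (alg_mate s G)|%:R.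
  by rewrite mulr_sumr (eq_bigr _ (fun s _ => outE s)) sumrB sumr_const mulr_natl.
pose M : R := (max_matching_size G)%:R; rewrite -/M in n_le unm *.
have gain : S * (n%:R * (3 / k%:R)) <= S * (4 * M * (3 / k%:R)).
  apply: ler_wpM2l; first exact: ltW.
  by apply: ler_wpM2r => //; rewrite divr_ge0 // ltW.
have -> : (1 - 6 / k%:R) * M * S = (S * (2 * M) - S * (4 * M * (3 / k%:R))) / 2.
  by field; rewrite gt_eqF.
rewrite ler_pdivrMr // [leRHS]mulrC [leRHS]sumE; move: unm gain.
by rewrite !mulrDr; lra.
Qed.

Theorem algorithm_correct n d (G : sgraph n) : regular G d ->
  [/\ forall s : lca_seed algorithm n, matching G (lca_output G s),
      forall (s : lca_seed algorithm n) (e : {set 'I_n}), e \in edges G ->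
        (probes G (lca_query s e) <= probe_bound k)%N
    & (1 - 6 / k%:R) * (max_matching_size G)%:R <= expected_size R algorithm G].
Proof.
move=> regG; split=> [s|s e _|]; last exact: alg_expected regG.
  by rewrite alg_output; apply: matching_mate_edges; apply: is_mate_alg.
exact: alg_probes.
Qed.

End Algorithm.

(** * The number of probes *)

Import numFieldNormedType.Exports.
Local Open Scope classical_set_scope.
Local Open Scope ring_scope.

Section ProbeExponent.
Variable R : realType.
Implicit Types x eps : R.

Definition precision eps : nat := (Num.truncn (6 / eps)).+1.

(** The exponent for which the power of [1 / eps] equals the probe bound exactly; what remains is to
    estimate its growth. *)
Definition probe_exponent eps : R := ln (probe_bound (precision eps))%:R / ln (1 / eps).

Lemma precision_gt eps : 6 / eps < (precision eps)%:R.
Proof. exact: truncnS_gt. Qed.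

Lemma precision_le eps : 0 < eps < 1 -> (precision eps)%:R <= 7 * (1 / eps).
Proof.
move=> /andP[e0 e1]; rewrite /precision -natr1.
have le : (Num.truncn (6 / eps))%:R <= 6 / eps.
  by rewrite truncn_le // divr_ge0 // ltW.
have : 1 <= 1 / eps by rewrite ler_pdivlMr // mul1r ltW.
by move: le; rewrite mul1r; lra.
Qed.

Lemma probe_bound_gt0 k : (0 < (probe_bound k)%:R :> R).
Proof. by rewrite ltr0n expn_gt0. Qed.

Lemma powR_probe_exponent eps : 0 < eps < 1 ->
  (1 / eps) `^ (probe_exponent eps) = (probe_bound (precision eps))%:R.
Proof.
move=> /andP[e0 e1]; have y1 : 1 < 1 / eps by rewrite ltr_pdivlMr // mul1r.
rewrite /powR gt_eqF; last by apply: lt_trans y1.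
by rewrite /probe_exponent divfK ?gt_eqF ?ln_gt0 // lnK // posrE probe_bound_gt0.
Qed.

Lemma ln_probe_bound eps : 0 < eps < 1 / 2 ->
  ln (probe_bound (precision eps))%:R <=
  (28 * 128 ^ 2).+1%:R * (49 * (1 / eps) ^+ 2) * (17 * ln (1 / eps)).
Proof.
move=> /andP[e0 e1]; set k := precision eps; pose y := 1 / eps.
have y2 : 2 <= y by rewrite ler_pdivlMr //; lra.
have k_le : k%:R <= 7 * y by apply: precision_le; rewrite e0 /=; lra.
have k1 : 1 <= k%:R :> R by rewrite ler1n.
have y_gt0 : 0 < y by lra.
rewrite /probe_bound natrX lnXn ?ltr0n // -[leLHS]mulr_natl; apply: ler_pM.
- by rewrite ler0n.
- by rewrite ln_ge0 // ler1n.
- apply: (@le_trans _ _ ((28 * 128 ^ 2).+1%:R * (k ^ 2)%:R)).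
    rewrite -natrM ler_nat expnMn mulnA; move: (28 * 128 ^ 2)%N => a.
    by rewrite mulSn -[leqLHS]add1n leq_add2r expn_gt0.
  apply: ler_wpM2l; first by rewrite ler0n.
  rewrite natrX -/y (_ : 49 * y ^+ 2 = (7 * y) ^+ 2); last by ring.
  have y7 : 0 <= 7 * y by lra.
  by rewrite lerXn2r ?nnegrE ?ler0n.
(* As [y >= 2], both [k <= 7 y <= y^4] and [17 <= y^5] hold, so [17 k^3 <= y^(5 + 12)]. *)
have base : ((16 * k ^ 3).+1)%:R <= y ^+ 17.
  have k4 : k%:R <= y ^+ 4.
    apply: (le_trans k_le); rewrite exprSr ler_wpM2r ?(ltW y_gt0) //.
    have : 2 ^+ 3 <= y ^+ 3 by rewrite lerXn2r ?nnegrE //; lra.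
    by rewrite !exprS expr0; lra.
  have y5 : 17 <= y ^+ 5.
    have : 2 ^+ 5 <= y ^+ 5 by rewrite lerXn2r ?nnegrE //; lra.
    by apply: le_trans; rewrite -natrX ler_nat.
  apply: (@le_trans _ _ (17 * k%:R ^+ 3)).
    rewrite -natrX -natrM ler_nat.
    have : (0 < k ^ 3)%N by rewrite expn_gt0.
    by lia.
  have -> : y ^+ 17 = y ^+ 5 * (y ^+ 4) ^+ 3 by rewrite -exprM -exprD.
  by apply: ler_pM => //; rewrite ?exprn_ge0 ?ler0n // lerXn2r ?nnegrE ?ler0n ?exprn_ge0 // ltW.
rewrite mulr_natl -lnXn // ler_ln ?posrE ?ltr0n ?exprn_gt0 //.
Qed.

Lemma probe_exponent_bigO : probe_exponent =O_ (0^'+) (fun x : R => 1 / x ^+ 2).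
Proof.
apply/eqO_exP; exists ((28 * 128 ^ 2).+1%:R * 49 * 17); first by rewrite !mulr_gt0 ?ltr0n.
near=> x.
have x0 : 0 < x by near: x; exact: nbhs_right_gt.
have x1 : x < 1 / 2 by near: x; apply: nbhs_right_lt; rewrite divr_gt0.
have y1 : 1 < 1 / x by rewrite ltr_pdivlMr //; lra.
have ly := ln_gt0 y1.
have pb1 : 1 <= (probe_bound (precision x))%:R :> R by rewrite ler1n expn_gt0.
rewrite ger0_norm; last by rewrite divr_ge0 ?ln_ge0 // ltW.
rewrite ger0_norm; last by rewrite divr_ge0 // exprn_ge0 // ltW.
rewrite ler_pdivrMr //; apply: (le_trans (ln_probe_bound _)); first by rewrite x0 x1.
have -> : (1 / x) ^+ 2 = 1 / x ^+ 2 by rewrite expr_div_n expr1n.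
rewrite le_eqVlt; apply/orP; left; apply/eqP.
by ring.
Unshelve. all: by end_near.
Qed.

End ProbeExponent.

Theorem theorem7 (R : realType) :
  exists f : R -> R,
    f =O_ (0^'+) (fun x : R => 1 / x ^+ 2) /\
    forall eps : R, 0 < eps ->
    exists A : lca,
    forall (n d : nat) (G : sgraph n), regular G d ->
      [/\ forall s : lca_seed A n, matching G (lca_output G s),
          forall (s : lca_seed A n) (e : {set 'I_n}), e \in edges G ->
            (probes G (lca_query s e))%:R <= (1 / eps) `^ (f eps)
        & (1 - eps) * (max_matching_size G)%:R <= expected_size R A G].
Proof.
exists (@probe_exponent R); split; first exact: probe_exponent_bigO.
(* For [eps >= 1] the required size is not positive, and the empty matching needs no probes. *)
move=> eps e0; have [e1|e1] := leP 1 eps.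
  exists idle_lca => n d G regG; split=> [s|s e _|].
  - exact: matching_idle.
  - exact: powR_ge0.
  - apply: (@le_trans _ _ 0); first by rewrite mulr_le0_ge0 ?ler0n // subr_le0.
    by rewrite divr_ge0 ?ler0n // sumr_ge0.
have k_gt0 : (0 < precision eps)%N by [].
exists (algorithm R k_gt0) => n d G regG.
have [out pr ex] := algorithm_correct R k_gt0 regG; split=> // [s e eE|].
  by rewrite powR_probe_exponent ?e0 // ler_nat pr.
apply: le_trans ex; apply: ler_wpM2r; first by rewrite ler0n.
have kR : 0 < (precision eps)%:R :> R by rewrite ltr0n.
rewrite lerD2l lerN2 ler_pdivrMr // mulrC -ler_pdivrMr //.
exact: ltW (precision_gt eps).
Qed.
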